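(* Let $K$ be a reproducing kernel on $\mathbb{B}^n$, $\mathbf{R}=\{R_1,\dots,R_N\}\subset SO(n)$ viewing angles, $\mathbf{F}=\{\mathbf{x}_1,\dots,\mathbf{x}_M\}\subset\mathbb{B}^{n-1}$ an evaluation grid, and $\nu>0$. Let $f^0\in\mathbb{H}(K)$ and let the observations be $y_{ij}=\mathcal{P}_{R_i}f^0(\mathbf{x}_j)+\varepsilon_{ij}$ with $\varepsilon_{ij}$ i.i.d. $N(0,\sigma^2)$, $1\le i\le N$, $1\le j\le M$; put $\mathbf{Y}=\mathrm{vec}[y_{ij}]\in\mathbb{R}^{NM}$ and $\hat L^\nu(f)=\sum_{i=1}^N\sum_{j=1}^M(y_{ij}-\mathcal{P}_{R_i}f(\mathbf{x}_j))^2+\nu\|f\|^2_{\mathbb{H}(K)}$ for $f\in\mathbb{H}(K)$. With the Gram matrix $\mathbf{W}$, the space $\mathbb{H}^{\mathbf{R}}_{\mathbf{F}}$, the isomorphism $\mathcal{I}:=\mathcal{I}^{\mathbf{R}}_{\mathbf{F}}:(\mathbb{H}^{\mathbf{R}}_{\mathbf{F}},\langle\cdot,\cdot\rangle_{\mathbb{H}(K)})\to(\mathcal{R}(\mathbf{W}),\langle\cdot,\cdot\rangle_{\mathbf{W}})$ and the coefficient vector $\boldsymbol{\alpha}^0$ of $f^0$ defined in the context: (1) The unique minimizer of $\hat L^\nu(f)$ over $f\in\mathbb{H}(K)$ is $\hat f^\nu=\sum_{i=1}^N\sum_{j=1}^M\hat\alpha^\nu_{ij}\mathcal{P}_{R_i}^*\tilde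 k^{R_i}_{\mathbf{x}_j}\in\mathbb{H}^{\mathbf{R}}_{\mathbf{F}}$, where $\hat{\boldsymbol{\alpha}}^\nu:=(\mathbf{W}+\nu\mathbf{I})^{-1}\mathbf{Y}$. (2) The minimum of the empirical risk is $$\min_{f\in\mathbb{H}(K)}\hat L^\nu(f)=\min_{\boldsymbol{\alpha}\in\mathbb{R}^{NM}}\hat L^\nu(\boldsymbol{\alpha})=\hat L^\nu(\hat{\boldsymbol{\alpha}}^\nu)=\nu\mathbf{Y}^\top(\mathbf{W}+\nu\mathbf{I})^{-1}\mathbf{Y},$$ where $\hat L^\nu(\boldsymbol{\alpha}):=\|\mathbf{Y}-\mathbf{W}\boldsymbol{\alpha}\|^2+\nu\boldsymbol{\alpha}^\top\mathbf{W}\boldsymbol{\alpha}$. (3) $\hat{\boldsymbol{\alpha}}^\nu\sim N(\mathbf{W}(\mathbf{W}+\nu\mathbf{I})^{-1}\boldsymbol{\alpha}^0,\ \sigma^2(\mathbf{W}+\nu\mathbf{I})^{-2})$, and $\hat f^\nu$ is the finite-dimensional degenerate Gaussian process $$\hat f^\nu\sim N\big(\mathcal{I}^{-1}(\mathbf{W}^2(\mathbf{W}+\nu\mathbf{I})^{-1}\boldsymbol{\alpha}^0),\ \sigma^2\,\mathcal{I}^{-1}\circ(\mathbf{W}(\mathbf{W}+\nu\mathbf{I})^{-2})\circ\mathcal{I}\big).$$ (4) As $\nu\downarrow0$, $\hat{\boldsymbol{\alpha}}^\nu$ and $\hat f^\nu$ converge to $\hat{\boldsymbol{\alpha}}^0$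 and $\hat f^0$ in $\mathbb{R}^{NM}$ and $\mathbb{H}(K)$, respectively: $\lim_{\nu\downarrow0}\hat{\boldsymbol{\alpha}}^\nu=\hat{\boldsymbol{\alpha}}^0$, $\lim_{\nu\downarrow0}\hat f^\nu=\hat f^0$, where $\hat{\boldsymbol{\alpha}}^0:=\mathbf{W}^\dagger\mathbf{Y}$ and $\hat f^0:=\sum_{i,j}\hat\alpha^0_{ij}\mathcal{P}_{R_i}^*\tilde k^{R_i}_{\mathbf{x}_j}$.
   Context: Throughout $n\ge2$. $\mathbb{B}^m$ is the closed unit ball of $\mathbb{R}^m$; $[\mathbf{x}:z]\in\mathbb{R}^n$ is the concatenation of $\mathbf{x}\in\mathbb{R}^{n-1}$ and $z\in\mathbb{R}$; $I_{\|\mathbf{x}\|}:=[-\sqrt{1-\|\mathbf{x}\|^2},\sqrt{1-\|\mathbf{x}\|^2}]$. A reproducing kernel $K$ on a set is a real symmetric positive semidefinite function, $\mathbb{H}(K)$ its RKHS of real functions, $k_{\mathbf{z}}=K(\cdot,\mathbf{z})$. For $R\in SO(n)$: $\mathcal{P}_Rf(\mathbf{x})=\int_{I_{\|\mathbf{x}\|}}f(R^\top[\mathbf{x}:z])\,dz$ (X-ray transform); $\tilde K^R(\mathbf{x}_1,\mathbf{x}_2)=\int_{I_{\|\mathbf{x}_2\|}}\int_{I_{\|\mathbf{x}_1\|}}K(R^\top[\mathbf{x}_1:z_1],R^\top[\mathbf{x}_2:z_2])\,dz_1dz_2$ (induced kernel on $\mathbb{B}^{n-1}$; the integrals are assumed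 to exist, as is automatic for continuous $K$), $\tilde k^R_{\mathbf{x}}=\tilde K^R(\cdot,\mathbf{x})$. $\mathcal{P}_R:\mathbb{H}(K)\to\mathbb{H}(\tilde K^R)$ is a bounded operator with Hilbert adjoint $\mathcal{P}_R^*$. Discrete setup: $\mathbb{H}^{\mathbf{R}}_{\mathbf{F}}:=\mathrm{span}\{\mathcal{P}_{R_i}^*\tilde k^{R_i}_{\mathbf{x}_j}:1\le i\le N,1\le j\le M\}\subset\mathbb{H}(K)$, and $\Pi^{\mathbf{R}}_{\mathbf{F}}$ is the orthogonal projection of $\mathbb{H}(K)$ onto it. $\mathrm{vec}$ denotes vectorization of an array indexed by $(i,j)$. The Gram matrix is $\mathbf{W}=[w_{ij,i'j'}]\in\mathbb{R}^{NM\times NM}$, $w_{ij,i'j'}=\langle\mathcal{P}_{R_i}^*\tilde k^{R_i}_{\mathbf{x}_j},\mathcal{P}_{R_{i'}}^*\tilde k^{R_{i'}}_{\mathbf{x}_{j'}}\rangle_{\mathbb{H}(K)}$; its range $\mathcal{R}(\mathbf{W})$ carries the inner product $\langle\mathbf{W}\boldsymbol\alpha,\mathbf{W}\boldsymbol\beta\rangle_{\mathbf{W}}=\boldsymbol\alpha^\top\mathbf{W}\boldsymbol\beta$. The map $\mathcal{I}^{\mathbf{R}}_{\mathbf{F}}:\mathbb{H}^{\mathbf{R}}_{\mathbf{F}}\to\mathcal{R}(\mathbf{W})$, $\sum_{i,j}\alpha_{ij}\mathcal{P}_{R_i}^*\tilde k^{R_i}_{\mathbf{x}_j}\mapsto\mathbf{W}\boldsymbol\alpha$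 ($\boldsymbol\alpha=\mathrm{vec}[\alpha_{ij}]$), is an isomorphism of inner product spaces. $\boldsymbol\alpha^0=\mathrm{vec}[\alpha^0_{ij}]$ denotes coefficients with $\Pi^{\mathbf{R}}_{\mathbf{F}}f^0=\sum_{i,j}\alpha^0_{ij}\mathcal{P}_{R_i}^*\tilde k^{R_i}_{\mathbf{x}_j}$. $\dagger$ is the Moore–Penrose inverse. $N(m,C)$ on $\mathbb{H}^{\mathbf{R}}_{\mathbf{F}}$ is the Gaussian law with mean $m$ and covariance operator $C$, $Ch=\mathbb{E}[(X-m)\langle X-m,h\rangle_{\mathbb{H}(K)}]$.
   Formalization: In (4), the limit of the coefficient vectors is claimed only for outcomes with Y in the range of W (automatic if W is invertible); otherwise the coefficients diverge as ν↓0, e.g. for K=0. The limit of the estimators in H(K) holds without this condition. *)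

(* Defs.v *)
From HB Require Import structures.
From mathcomp Require Import all_boot all_order all_algebra.
From mathcomp Require Import all_classical all_reals all_analysis.

Set Implicit Arguments.
Unset Strict Implicit.
Unset Printing Implicit Defensive.

Import Order.TTheory GRing.Theory Num.Theory.
Import numFieldNormedType.Exports.

Local Open Scope classical_set_scope.
Local Open Scope ring_scope.

Definition reproducing_kernel (R : realType) (T : Type) (K : T -> T -> R) :=
  (forall x y, K x y = K y x) /\
  (forall (p : nat) (z : 'I_p -> T) (c : 'I_p -> R),
     0 <= \sum_(i < p) \sum_(j < p) c i * c j * K (z i) (z j)).

(* A Hilbert space of real functions on [T] with reproducing kernel [K].
   By the Moore-Aronszajn theorem there is exactly one when [K] is a
   reproducing kernel, up to the values of [ip] outside the carrier, which are
   unconstrained and irrelevant. *)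
Record rkhs (R : realType) (T : Type) (K : T -> T -> R) := Rkhs {
  carrier :> (T -> R) -> Prop ;
  ip : (T -> R) -> (T -> R) -> R ;
  rkhs0 : carrier 0 ;
  rkhsP : forall (a : R) f g, carrier f -> carrier g -> carrier (a *: f + g) ;
  ipC : forall f g, carrier f -> carrier g -> ip f g = ip g f ;
  ipP : forall (a : R) f g h, carrier f -> carrier g -> carrier h ->
    ip (a *: f + g) h = a * ip f h + ip g h ;
  ip_ge0 : forall f, carrier f -> 0 <= ip f f ;
  ip_eq0 : forall f, carrier f -> ip f f = 0 -> f = 0 ;
  rkhs_complete : forall u : nat -> T -> R, (forall k, carrier (u k)) ->
    (forall e : R, 0 < e -> exists k0 : nat, forall k l : nat,
       (k0 <= k)%N -> (k0 <= l)%N -> ip (u k - u l) (u k - u l) < e) ->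
    exists2 f, carrier f & ip (u k - f) (u k - f) @[k --> \oo] --> (0 : R) ;
  rkhs_kernel : forall z, carrier (fun x => K x z) ;
  rkhs_reproducing : forall f z, carrier f -> f z = ip f (fun x => K x z)
}.

Definition hnorm (R : realType) (T : Type) (K : T -> T -> R) (H : rkhs K)
    (f : T -> R) : R := Num.sqrt (ip H f f).

Definition bounded_operator (R : realType) (T1 T2 : Type)
    (K1 : T1 -> T1 -> R) (K2 : T2 -> T2 -> R) (H1 : rkhs K1) (H2 : rkhs K2)
    (A : (T1 -> R) -> T2 -> R) :=
  [/\ forall f, H1 f -> H2 (A f),
      forall (a : R) f g, H1 f -> H1 g -> A (a *: f + g) = a *: A f + A g
    & exists C : R, forall f, H1 f -> hnorm H2 (A f) <= C * hnorm H1 f].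

Definition is_adjoint (R : realType) (T1 T2 : Type)
    (K1 : T1 -> T1 -> R) (K2 : T2 -> T2 -> R) (H1 : rkhs K1) (H2 : rkhs K2)
    (A : (T1 -> R) -> T2 -> R) (B : (T2 -> R) -> T1 -> R) :=
  (forall g, H2 g -> H1 (B g)) /\
  (forall f g, H1 f -> H2 g -> ip H2 (A f) g = ip H1 f (B g)).

Definition is_orth_proj (R : realType) (T : Type) (K : T -> T -> R)
    (H : rkhs K) (V : set (T -> R)) (f g : T -> R) :=
  V g /\ forall h, V h -> ip H (f - g) h = 0.

Definition sqnorm (R : realType) (n : nat) (v : 'cV[R]_n) : R :=
  \sum_(i < n) v i 0 ^+ 2.

Definition cball (R : realType) (n : nat) := {v : 'cV[R]_n | sqnorm v <= 1}.

Lemma sqnorm0_le1 (R : realType) (n : nat) : sqnorm (0 : 'cV[R]_n) <= 1.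
Proof. by rewrite /sqnorm big1 ?ler01// => i _; rewrite mxE expr0n. Qed.

(* The point of the ball with coordinates [v]; the default value (the centre)
   is never reached below, all points being of norm at most 1. *)
Definition to_cball (R : realType) (n : nat) (v : 'cV[R]_n) : cball R n :=
  insubd (exist _ 0 (sqnorm0_le1 R n)) v.

(* [x : z] in R^n, for x in R^(n-1); [insub i] is [None] for i = n - 1 only. *)
Definition concat (R : realType) (n : nat) (x : 'cV[R]_n.-1) (z : R)
  : 'cV[R]_n := \col_(i < n) oapp (fun j : 'I_n.-1 => x j 0) z (insub (val i)).

Definition chord (R : realType) (m : nat) (x : cball R m) : set R :=
  let r := Num.sqrt (1 - sqnorm (val x)) in `[- r, r].

Definition ray_point (R : realType) (n : nat) (U : 'M[R]_n) (x : cball R n.-1)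
  (z : R) : cball R n := to_cball (U^T *m concat (val x) z).

Definition SO (R : realType) (n : nat) : set 'M[R]_n :=
  [set U | U^T *m U = 1%:M /\ \det U = 1].

Definition xray (R : realType) (n : nat) (U : 'M[R]_n) (f : cball R n -> R)
    (x : cball R n.-1) : R :=
  \int[lebesgue_measure]_(z in chord x) f (ray_point U x z).

Definition induced_kernel (R : realType) (n : nat)
    (K : cball R n -> cball R n -> R) (U : 'M[R]_n) (x1 x2 : cball R n.-1) : R :=
  \int[lebesgue_measure]_(z2 in chord x2)
    \int[lebesgue_measure]_(z1 in chord x1)
      K (ray_point U x1 z1) (ray_point U x2 z2).

Definition xray_exists (R : realType) (n : nat) (U : 'M[R]_n)
    (f : cball R n -> R) :=
  forall x : cball R n.-1, (@lebesgue_measure R).-integrable (chord x)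
    (fun z => (f (ray_point U x z))%:E).

Definition induced_kernel_exists (R : realType) (n : nat)
    (K : cball R n -> cball R n -> R) (U : 'M[R]_n) :=
  forall x1 x2 : cball R n.-1,
    (forall z2, chord x2 z2 ->
       (@lebesgue_measure R).-integrable (chord x1)
         (fun z1 => (K (ray_point U x1 z1) (ray_point U x2 z2))%:E)) /\
    (@lebesgue_measure R).-integrable (chord x2)
      (fun z2 => (\int[lebesgue_measure]_(z1 in chord x1)
                    K (ray_point U x1 z1) (ray_point U x2 z2))%:E).

Definition vec (T : Type) (N M : nat) (a : 'I_N -> 'I_M -> T) : 'cV[T]_(N * M) :=
  (mxvec (\matrix_(i < N, j < M) a i j))^T.

(* sum_ij alpha_ij phi_ij, for alpha = vec [alpha_ij] *)
Definition lincomb (R : realType) (T : Type) (N M : nat)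
    (phi : 'I_N -> 'I_M -> T -> R) (alpha : 'cV[R]_(N * M)) : T -> R :=
  \sum_(i < N) \sum_(j < M) alpha (mxvec_index i j) 0 *: phi i j.

Definition fspan (R : realType) (T : Type) (N M : nat)
    (phi : 'I_N -> 'I_M -> T -> R) : set (T -> R) := range (lincomb phi).

Definition gram (R : realType) (T : Type) (K : T -> T -> R) (H : rkhs K)
    (N M : nat) (phi : 'I_N -> 'I_M -> T -> R) : 'M[R]_(N * M) :=
  \matrix_(k, l) ip H (vec phi k 0) (vec phi l 0).

(* The map I : sum_ij alpha_ij phi_ij |-> W alpha, W being the Gram matrix; the
   value does not depend on the representation chosen by [xget]. *)
Definition gram_iso (R : realType) (T : Type) (K : T -> T -> R) (H : rkhs K)
    (N M : nat) (phi : 'I_N -> 'I_M -> T -> R) (f : T -> R) : 'cV[R]_(N * M) :=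
  gram H phi *m xget 0 [set alpha | lincomb phi alpha = f].

Definition gram_iso_inv (R : realType) (T : Type) (K : T -> T -> R)
    (H : rkhs K) (N M : nat) (phi : 'I_N -> 'I_M -> T -> R)
    (v : 'cV[R]_(N * M)) : T -> R :=
  xget 0 [set f | fspan phi f /\ gram_iso H phi f = v].

(* Moore-Penrose inverse of a real matrix: the unique solution of the four
   Penrose equations. *)
Definition moore_penrose (R : realType) (m n : nat) (A : 'M[R]_(m, n)) : 'M[R]_(n, m) :=
  xget 0 [set X | [/\ A *m X *m A = A, X *m A *m X = X,
                      (A *m X)^T = A *m X & (X *m A)^T = X *m A]].

(* N(m, v) on the real line, with mean m and variance v >= 0; [normal_prob]
   takes the standard deviation and is not a Dirac mass when that is 0. *)
Definition normal_law (R : realType) (m v : R) : set R -> \bar R :=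
  if v == 0 then fun B => \d_m B else fun B => normal_prob m (Num.sqrt v) B.

Definition has_law (d : measure_display) (Omega : measurableType d)
    (R : realType) (P : probability Omega R) (X : Omega -> R)
    (mu : set R -> \bar R) :=
  measurable_fun setT X /\
  forall B : set R, measurable B -> P (X @^-1` B) = mu B.

Definition is_normal (d : measure_display) (Omega : measurableType d)
    (R : realType) (P : probability Omega R) (X : Omega -> R) :=
  exists m v : R, 0 <= v /\ has_law P X (normal_law m v).

Definition mutually_independent (d : measure_display)
    (Omega : measurableType d) (R : realType) (P : probability Omega R)
    (I : finType) (X : I -> Omega -> R) :=
  forall (J : {set I}) (B : I -> set R), (forall i, measurable (B i)) ->
    P (\bigcap_(i in [set` J]) (X i @^-1` B i)) =
    (\prod_(i in J) P (X i @^-1` B i))%E.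

(* [X] is a (possibly degenerate) Gaussian vector with mean [m] and covariance
   matrix [S]. *)
Definition gaussian_vector (d : measure_display) (Omega : measurableType d)
    (R : realType) (P : probability Omega R) (k : nat)
    (X : Omega -> 'cV[R]_k) (m : 'cV[R]_k) (S : 'M[R]_k) :=
  [/\ forall a : 'cV[R]_k, is_normal P (fun w => (a^T *m X w) 0 0),
      forall i, ('E_P[(fun w => X w i 0)%R] = (m i 0)%:E)%E
    & forall i j, covariance P (fun w => X w i 0) (fun w => X w j 0) =
                  (S i j)%:E].

(* [X] is a Gaussian random element of the (finite-dimensional) subspace [V] of
   [H] with mean [m] and covariance operator C h = E[(X - m) <X - m, h>], the
   vector-valued expectations being tested against the elements of [V]. *)
Definition gaussian_element (d : measure_display) (Omega : measurableType d)
    (R : realType) (P : probability Omega R) (T : Type) (K : T -> T -> R)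
    (H : rkhs K) (V : set (T -> R)) (X : Omega -> T -> R) (m : T -> R)
    (C : (T -> R) -> T -> R) :=
  [/\ forall w, V (X w),
      forall h, V h -> is_normal P (fun w => ip H (X w) h),
      V m /\ (forall h, V h -> ('E_P[(fun w => ip H (X w) h)%R] = (ip H m h)%:E)%E)
    & forall h, V h -> V (C h) /\
        forall g, V g ->
          ('E_P[(fun w => ip H (X w - m) g * ip H (X w - m) h)%R]
           = (ip H (C h) g)%:E)%E].

Definition is_min (R : realType) (A : set R) (v : R) := A v /\ lbound A v.

Definition emp_risk (R : realType) (n N M : nat)
    (K : cball R n -> cball R n -> R) (H : rkhs K) (U : 'I_N -> 'M[R]_n)
    (x : 'I_M -> cball R n.-1) (nu : R) (y : 'I_N -> 'I_M -> R)
    (f : cball R n -> R) : R :=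
  \sum_(i < N) \sum_(j < M) (y i j - xray (U i) f (x j)) ^+ 2
  + nu * hnorm H f ^+ 2.

Definition emp_risk_vec (R : realType) (k : nat) (W : 'M[R]_k) (nu : R)
    (Y alpha : 'cV[R]_k) : R :=
  sqnorm (Y - W *m alpha) + nu * (alpha^T *m W *m alpha) 0 0.

Definition alpha_hat (R : realType) (k : nat) (W : 'M[R]_k) (Y : 'cV[R]_k)
  (nu : R) : 'cV[R]_k := invmx (W + nu%:M) *m Y.

(* Main.v *)
Require Import Defs.
From mathcomp Require Import all_boot all_order all_algebra.
From mathcomp Require Import all_classical all_reals all_analysis.
From mathcomp Require Import measurable_realfun ring lra.

Set Implicit Arguments.
Unset Strict Implicit.
Unset Printing Implicit Defensive.

Import Order.TTheory GRing.Theory Num.Theory.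
Import numFieldNormedType.Exports.

Local Open Scope classical_set_scope.
Local Open Scope ring_scope.

(** Write $\phi_{ij}$ for the adjoint image of the kernel section at $x_j$ for the angle
    $R_i$. By the reproducing property in the induced space and the adjoint relation, the
    X-ray value of $f$ at $x_j$ is $\langle f,\phi_{ij}\rangle$, so only the vector of
    samples of $f$ against the $\phi_{ij}$ enters the data, and the problem is ridge
    regression with Gram matrix $W$, which is symmetric and positive semidefinite.

    Minimization. The coefficients $\hat\alpha=(W+\nu)^{-1}Y$ satisfy the normal equations
    $Y-W\hat\alpha=\nu\hat\alpha$ [resolventE]; these cancel the cross terms in the risk of
    $\hat f+g$, which is therefore the risk of $\hat f$ plus a form in $g$ that is at least
    $\nu\|g\|^2$ [ridge_risk_split]. Minimality, uniqueness and the minimal value follow.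

    Law. Since $f^0$ and its projection have the same samples, $Y=W\alpha^0+\varepsilon$,
    and both the coefficients and the estimator are affine images of the noise. What has to
    be proved is that a linear functional of independent normal variables is normal with the
    expected variance. Two normal laws convolve to a normal law by completing the square
    [normal_conv]; variables are added one at a time, the independence needed at each step
    being drawn from the uniqueness of product measures [normal_add_indep,
    normal_sum_indep]. Means come from symmetry and variances from the second moment of the
    Gaussian function [integral_sqr_gauss], both by standardization [normal_law_moments];
    covariances then follow by polarization [noise_cov].

    Limit. Let $p=W^\dagger Y$. It lies in the range of $W$, say $p=Wq$, and
    $(W+\nu)^{-1}Wp-p=-\nu W(W+\nu)^{-1}q$, where $W(W+\nu)^{-1}$ is a contraction
    [resolvent_contraction]; so the error is $O(\nu)$ when $Y=Wp$. In general $Y-Wp$ is in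
    the kernel of $W$, hence it does not contribute to the error of the estimator, whose
    squared norm is the quadratic form of $W$ at the error of the coefficients. *)

(** * Resolvents of positive semidefinite matrices, Moore-Penrose inverse *)

Section psd.
Context {R : realType} {k : nat}.
Implicit Types (a b u v Y q : 'cV[R]_k) (W X : 'M[R]_k) (nu : R).

Definition psd_mx W := W^T = W /\ forall a, 0 <= (a^T *m W *m a) 0 0.

Lemma dot_sqnorm a : (a^T *m a) 0 0 = sqnorm a.
Proof. by rewrite mxE /sqnorm; apply: eq_bigr => i _; rewrite mxE expr2. Qed.

Lemma dotC a b : (a^T *m b) 0 0 = (b^T *m a) 0 0.
Proof. by rewrite !mxE; apply: eq_bigr => i _; rewrite !mxE mulrC. Qed.

Lemma sqnorm_ge0 a : 0 <= sqnorm a.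
Proof. by apply: sumr_ge0 => i _; rewrite sqr_ge0. Qed.

Lemma sqnorm_eq0 a : sqnorm a = 0 -> a = 0.
Proof.
move=> /eqP; rewrite psumr_eq0 => [/allP h|i _]; last exact: sqr_ge0.
apply/colP => i; rewrite mxE; apply/eqP.
by rewrite -sqrf_eq0; apply: h; rewrite mem_index_enum.
Qed.

Lemma sqnormB a b : sqnorm (a - b) = sqnorm a - 2 * (a^T *m b) 0 0 + sqnorm b.
Proof.
rewrite -!dot_sqnorm !raddfB/= !mulmxBl !mxE/=.
have := dotC b a; rewrite !mxE => ->.
ring.
Qed.

(** Positivity of $W$ turns $v(W+\nu)=0$ into $\nu\|v\|^2 \le 0$. *)
Lemma resolvent_unit W nu : psd_mx W -> 0 < nu -> W + nu%:M \in unitmx.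
Proof.
move=> [Wsym Wpos] nu0; rewrite -row_free_unit -kermx_eq0.
apply/negPn/negP => /rowV0Pn [v /sub_kermxP vk /eqP v0]; apply: v0.
apply: trmx_inj; rewrite trmx0; apply: sqnorm_eq0.
have : (v *m (W + nu%:M) *m v^T) 0 0 = 0 by rewrite vk mul0mx mxE.
rewrite mulmxDr mulmxDl mul_mx_scalar -scalemxAl mxE [X in _ + X]mxE.
have := Wpos v^T; have := sqnorm_ge0 v^T; rewrite -dot_sqnorm trmxK.
move=> v2 Wv h; have : nu * (v *m v^T) 0 0 = 0.
  by apply/eqP; rewrite eq_le; apply/andP; split; [lra|exact: mulr_ge0 (ltW nu0) v2].
by move=> /eqP; rewrite mulf_eq0 gt_eqF//= => /eqP.
Qed.

Lemma resolvent_tr W nu : psd_mx W -> (invmx (W + nu%:M))^T = invmx (W + nu%:M).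
Proof. by move=> [Wsym _]; rewrite trmx_inv raddfD/= tr_scalar_mx Wsym. Qed.

Lemma resolvent_comm W nu : psd_mx W -> 0 < nu ->
  invmx (W + nu%:M) *m W = W *m invmx (W + nu%:M).
Proof.
move=> Wpsd nu0; have Wu := resolvent_unit Wpsd nu0.
apply: (can_inj (mulKmx Wu)); rewrite mulKVmx// mulmxA.
have -> : (W + nu%:M) *m W = W *m (W + nu%:M).
  by rewrite mulmxDl mulmxDr mul_scalar_mx mul_mx_scalar.
by rewrite mulmxK.
Qed.

(** The normal equations of ridge regression. *)
Lemma resolventE W nu Y : psd_mx W -> 0 < nu ->
  W *m alpha_hat W Y nu = Y - nu *: alpha_hat W Y nu.
Proof.
move=> Wpsd nu0; have Wu := resolvent_unit Wpsd nu0.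
rewrite /alpha_hat -{2}(mulKVmx Wu Y) mulmxDl mul_scalar_mx addrK.
by [].
Qed.

(** Pairing $Wu = q-\nu u$ with $u=(W+\nu)^{-1}q$ gives $u\cdot q \ge \nu\|u\|^2$, as
    $u^TWu \ge 0$; expanding $\|q-\nu u\|^2$ then gives the bound. *)
Lemma resolvent_contraction W nu q : psd_mx W -> 0 < nu ->
  sqnorm (W *m alpha_hat W q nu) <= sqnorm q.
Proof.
move=> Wpsd nu0.
have := resolventE q Wpsd nu0; set u := alpha_hat W q nu => Wu.
have h : 0 <= (u^T *m W *m u) 0 0 by case: Wpsd.
move: h; rewrite -mulmxA Wu mulmxBr -scalemxAr.
rewrite mxE [X in _ + X]mxE [X in _ - X]mxE dot_sqnorm dotC => h.
rewrite sqnormB -scalemxAr [X in 2 * X]mxE.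
have -> : sqnorm (nu *: u) = nu ^+ 2 * sqnorm u.
  by rewrite /sqnorm mulr_sumr; apply: eq_bigr => i _; rewrite mxE exprMn.
have := mulr_ge0 (ltW nu0) h.
have := mulr_ge0 (sqr_ge0 nu) (sqnorm_ge0 u); lra.
Qed.

Lemma alpha_hat_mul W nu q : psd_mx W -> 0 < nu ->
  alpha_hat W (W *m q) nu = W *m alpha_hat W q nu.
Proof. by move=> Wpsd nu0; rewrite /alpha_hat mulmxA resolvent_comm// -mulmxA. Qed.

End psd.

(** A full-rank factorization $A = CB$ yields the inverse $B^T(BB^T)^{-1}(C^TC)^{-1}C^T$. *)
Lemma penrose_ex (R : realType) (m n : nat) (A : 'M[R]_(m, n)) :
  exists X : 'M[R]_(n, m), [/\ A *m X *m A = A, X *m A *m X = X,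
    (A *m X)^T = A *m X & (X *m A)^T = X *m A].
Proof.
have gram_unit p q (D : 'M[R]_(p, q)) : row_free D -> D *m D^T \in unitmx.
  move=> Df; rewrite -row_free_unit -kermx_eq0.
  apply/negPn/negP => /rowV0Pn [v /sub_kermxP vk /eqP]; apply.
  have : (v *m D) = 0.
    apply: trmx_inj; rewrite trmx0; apply: sqnorm_eq0.
    by rewrite -dot_sqnorm trmxK trmx_mul mulmxA -(mulmxA v) vk mul0mx mxE.
  by rewrite -(mul0mx _ D); apply: row_free_inj.
have [r [B [C [Bf Cf AE]]]] : exists r (B : 'M[R]_(r, n)) (C : 'M[R]_(m, r)),
    [/\ row_free B, row_full C & A = C *m B].
  exists (\rank A), (row_base A), (col_base A).
  by rewrite row_base_free col_base_full mulmx_base.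
have BB : B *m B^T \in unitmx by exact: gram_unit.
have CC : C^T *m C \in unitmx.
  rewrite -{2}(trmxK C); apply: gram_unit.
  by rewrite /row_free mxrank_tr.
have sym p q (D : 'M[R]_(p,q)) : (invmx (D *m D^T))^T = invmx (D *m D^T).
  by rewrite trmx_inv trmx_mul trmxK.
have symC : (invmx (C^T *m C))^T = invmx (C^T *m C).
  by rewrite trmx_inv trmx_mul trmxK.
exists (B^T *m invmx (B *m B^T) *m invmx (C^T *m C) *m C^T).
have AX : A *m (B^T *m invmx (B *m B^T) *m invmx (C^T *m C) *m C^T)
    = C *m invmx (C^T *m C) *m C^T.
  by rewrite AE -!mulmxA (mulmxA B) (mulmxA (B *m B^T)) mulmxV// mul1mx.
have XA : (B^T *m invmx (B *m B^T) *m invmx (C^T *m C) *m C^T) *m A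
    = B^T *m invmx (B *m B^T) *m B.
  by rewrite AE -!mulmxA (mulmxA C^T) (mulmxA (invmx (C^T *m C))) mulVmx// mul1mx.
rewrite AX XA; split.
- by rewrite {1}AE -!mulmxA (mulmxA C^T) (mulmxA (invmx (C^T *m C))) mulVmx// mul1mx -AE.
- rewrite -!mulmxA; congr (_ *m (_ *m _)).
  by rewrite (mulmxA B) (mulmxA (B *m B^T)) mulmxV// mul1mx.
- by rewrite !trmx_mul trmxK symC mulmxA.
- by rewrite !trmx_mul trmxK sym mulmxA.
Qed.

Lemma moore_penroseP (R : realType) (m n : nat) (A : 'M[R]_(m, n)) :
  let X := moore_penrose A in
  [/\ A *m X *m A = A, X *m A *m X = X, (A *m X)^T = A *m X & (X *m A)^T = X *m A].
Proof.
rewrite /moore_penrose; case: xgetP => [X _ //|none].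
by have [X hX] := penrose_ex A; case: (none X).
Qed.

Section ridgeless_limit.
Context {R : realType} {k : nat}.
Variables (W : 'M[R]_k) (Y : 'cV[R]_k).
Hypothesis Wpsd : psd_mx W.
Let p := moore_penrose W *m Y.
Let q := (moore_penrose W)^T *m p.

(** Because $p = W^\dagger W p = (W^\dagger W)^T p = W (W^\dagger)^T p$. *)
Let pE : p = W *m q.
Proof.
have [_ XWX _ sym] := moore_penroseP W.
rewrite /q mulmxA -{1}(proj1 Wpsd) -trmx_mul sym /p mulmxA.
by rewrite XWX.
Qed.

(** The error is $-\nu$ times a vector bounded independently of $\nu$. *)
Lemma alpha_hat_range_err nu : 0 < nu ->
  alpha_hat W (W *m p) nu - p = - nu *: (W *m alpha_hat W q nu).
Proof.
move=> nu0; rewrite alpha_hat_mul// resolventE// addrAC subrr add0r.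
by rewrite {1}pE alpha_hat_mul// scaleNr.
Qed.

(** The residual $Y - Wp$ lies in the kernel of $W$, where $(W+\nu)^{-1}$ is division
    by $\nu$: it can make the coefficients blow up, but $W$ does not see it. *)
Lemma mul_alpha_hat_proj nu : 0 < nu ->
  W *m alpha_hat W Y nu = W *m alpha_hat W (W *m p) nu.
Proof.
move=> nu0; rewrite -!alpha_hat_mul//; congr (alpha_hat _ _ _).
have [WXW _ sym _] := moore_penroseP W.
have WWX : W *m (W *m moore_penrose W) = W.
  by rewrite -sym -{1}(proj1 Wpsd) -trmx_mul WXW (proj1 Wpsd).
by rewrite /p (mulmxA W (moore_penrose W)) mulmxA WWX.
Qed.

(** The left-hand side is the squared Hilbert norm of the error of the estimator; the
    residual $Y - Wp$ drops out of this quadratic form. *)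
Lemma gram_err_le nu (a := alpha_hat W Y nu - p) : 0 < nu ->
  (a^T *m W *m a) 0 0 <= nu ^+ 2 * (sqnorm q + sqnorm (W *m q)).
Proof.
move=> nu0; pose a' := alpha_hat W (W *m p) nu - p.
have Wa : W *m a = W *m a' by rewrite !mulmxBr mul_alpha_hat_proj.
have -> : (a^T *m W *m a) 0 0 = (a'^T *m (W *m a')) 0 0.
  have -> : a^T *m W = a'^T *m W.
    by apply: trmx_inj; rewrite !trmx_mul !trmxK (proj1 Wpsd).
  by rewrite -mulmxA Wa.
rewrite /a' alpha_hat_range_err// -!scalemxAr [(_ *: _)^T]linearZ/= -scalemxAl.
rewrite scalerA mulrNN -expr2 mxE ler_pM2l ?exprn_gt0//.
set r := W *m _; have Wr : W *m r = W *m alpha_hat W (W *m q) nu.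
  by rewrite alpha_hat_mul.
have r1 : sqnorm r <= sqnorm q by exact: resolvent_contraction.
have r2 : sqnorm (W *m r) <= sqnorm (W *m q).
  by rewrite Wr; exact: resolvent_contraction.
have := sqnorm_ge0 (r - W *m r); rewrite sqnormB.
have := sqnorm_ge0 r; have := sqnorm_ge0 (W *m r); lra.
Qed.

Lemma alpha_hat_cvg : (exists b : 'cV[R]_k, Y = W *m b) ->
  alpha_hat W Y nu @[nu --> 0^'+] --> p.
Proof.
move=> [b YE].
have Wp : W *m p = Y.
  by have [WXW _ _ _] := moore_penroseP W; rewrite /p YE !mulmxA WXW.
apply/cvgrPdist_le => e e0; near=> nu.
have nu0 : 0 < nu by near: nu; exact: nbhs_right_gt.
rewrite -Wp -normrN opprB alpha_hat_range_err// normrZ normrN gtr0_norm//.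
set r := W *m _; have : `|r| <= Num.sqrt (sqnorm q).
  rewrite [leLHS]mx_normrE; apply/bigmax_leP; split => //= -[i j] _ /=.
  rewrite ord1 -sqrtr_sqr ler_wsqrtr//.
  apply: le_trans (resolvent_contraction q Wpsd nu0).
  by rewrite /sqnorm (bigD1 i)//= lerDl sumr_ge0// => ? _; exact: sqr_ge0.
move=> /(ler_wpM2l (ltW nu0))/le_trans; apply.
have c0 : 0 < Num.sqrt (sqnorm q) + 1 by rewrite ltr_wpDl// sqrtr_ge0.
apply: (@le_trans _ _ (nu * (Num.sqrt (sqnorm q) + 1))).
  by rewrite ler_wpM2l ?lerDl// ltW.
rewrite -ler_pdivlMr//.
by near: nu; apply: nbhs_right_le; rewrite divr_gt0.
Unshelve. all: by end_near. Qed.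

End ridgeless_limit.

(** * Gram matrices and ridge regression in a reproducing kernel Hilbert space *)

Section inner_product.
Context {R : realType} {T : Type} {K : T -> T -> R} (H : rkhs K).
Implicit Types (f g h : T -> R) (c : R).

Lemma rkhsD f g : H f -> H g -> H (f + g).
Proof. by move=> Hf Hg; rewrite -[f]scale1r; exact: rkhsP. Qed.

Lemma rkhsB f g : H f -> H g -> H (f - g).
Proof. by move=> Hf Hg; rewrite addrC -scaleN1r; exact: rkhsP. Qed.

Lemma ip0l h : H h -> ip H 0 h = 0.
Proof.
move=> Hh; have H0 := rkhs0 H.
have := ipP 1 H0 H0 Hh; rewrite scaler0 addr0 mul1r => e.
by apply: (addrI (ip H 0 h)); rewrite addr0 -e.
Qed.

Lemma ipDl f g h : H f -> H g -> H h -> ip H (f + g) h = ip H f h + ip H g h.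
Proof. by move=> Hf Hg Hh; rewrite -{1}[f]scale1r ipP// mul1r. Qed.

Lemma ipBl f g h : H f -> H g -> H h -> ip H (f - g) h = ip H f h - ip H g h.
Proof.
by move=> Hf Hg Hh; rewrite addrC -scaleN1r ipP// mulN1r addrC.
Qed.

Lemma sqr_hnorm f : H f -> hnorm H f ^+ 2 = ip H f f.
Proof. by move=> Hf; rewrite sqr_sqrtr// ip_ge0. Qed.

Lemma ipDD f g : H f -> H g ->
  ip H (f + g) (f + g) = ip H f f + 2 * ip H f g + ip H g g.
Proof.
move=> Hf Hg; have Hfg := rkhsD Hf Hg.
rewrite ipDl// !(ipC _ Hfg)// !ipDl// (ipC Hg Hf); ring.
Qed.

End inner_product.

Section gram.
Context {R : realType} {T : Type} {K : T -> T -> R} (H : rkhs K) {N M : nat}.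
Variable phi : 'I_N -> 'I_M -> T -> R.
Hypothesis Hphi : forall i j, H (phi i j).
Implicit Types (a b : 'cV[R]_(N * M)) (f g h : T -> R) (c : R).

Let W := gram H phi.
Local Notation psi k := (vec phi k 0).

Lemma vecE (S : Type) (F : 'I_N -> 'I_M -> S) i j :
  vec F (mxvec_index i j) 0 = F i j.
Proof. by rewrite /vec mxE mxvecE mxE. Qed.

Lemma mxvec_index_surj (k : 'I_(N * M)) : exists i j, k = mxvec_index i j.
Proof. by case/mxvec_indexP: k => i j; exists i, j. Qed.

Lemma sum_mxvec_index (V : nmodType) (F : 'I_(N * M) -> V) :
  \sum_(i < N) \sum_(j < M) F (mxvec_index i j) = \sum_k F k.
Proof.
rewrite pair_bigA/= (reindex _ (curry_mxvec_bij N M)).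
by apply: eq_bigr => -[i j].
Qed.

Lemma rkhs_psi k : H (psi k).
Proof. by have [i [j ->]] := mxvec_index_surj k; rewrite vecE. Qed.

Lemma lincombE a : lincomb phi a = \sum_k a k 0 *: psi k.
Proof.
rewrite -sum_mxvec_index; apply: eq_bigr => i _; apply: eq_bigr => j _.
by rewrite vecE.
Qed.

Lemma lincombP c a b : lincomb phi (c *: a + b) = c *: lincomb phi a + lincomb phi b.
Proof.
rewrite !lincombE scaler_sumr -big_split; apply: eq_bigr => k _ /=.
by rewrite [X in X *: _]mxE [X in X + _]mxE scalerDl scalerA.
Qed.

Lemma lincombZ c a : lincomb phi (c *: a) = c *: lincomb phi a.
Proof.
by rewrite !lincombE scaler_sumr; apply: eq_bigr => k _; rewrite [X in X *: _]mxE scalerA.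
Qed.

Lemma lincombB a b : lincomb phi (a - b) = lincomb phi a - lincomb phi b.
Proof. by rewrite addrC -scaleN1r lincombP scaleN1r addrC. Qed.

(** When the $\phi_{ij}$ are the adjoint images of the kernel sections, these are the
    noiseless X-ray observations of $f$. *)
Definition samples f : 'cV[R]_(N * M) := \col_k ip H f (psi k).

Lemma samplesE f k : samples f k 0 = ip H f (psi k).
Proof. by rewrite mxE. Qed.

Lemma samplesB f g : H f -> H g -> samples (f - g) = samples f - samples g.
Proof.
move=> Hf Hg; apply/colP => k; rewrite samplesE ipBl//; last exact: rkhs_psi.
by rewrite -!samplesE [RHS]mxE [X in _ = _ + X]mxE.
Qed.

Let sum_ip (s : seq 'I_(N * M)) a f : H f ->
  H (\sum_(k <- s) a k 0 *: psi k) /\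
  ip H (\sum_(k <- s) a k 0 *: psi k) f = \sum_(k <- s) a k 0 * ip H (psi k) f.
Proof.
move=> Hf; elim: s => [|k s [Hs IH]].
  by rewrite !big_nil ip0l//; split=> //; exact: rkhs0.
rewrite !big_cons; have Hk := rkhs_psi k.
by split; [exact: rkhsP | rewrite ipP// IH].
Qed.

Lemma rkhs_lincomb a : H (lincomb phi a).
Proof. by rewrite lincombE; apply: (proj1 (sum_ip _ _ (rkhs0 H))). Qed.

Lemma ip_lincombl a f : H f -> ip H (lincomb phi a) f = (a^T *m samples f) 0 0.
Proof.
move=> Hf; rewrite lincombE (proj2 (sum_ip _ _ Hf)) mxE; apply: eq_bigr => k _.
rewrite samplesE ipC//; last exact: rkhs_psi.
by rewrite [X in _ = X * _]mxE.
Qed.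

Lemma samples_lincomb a : samples (lincomb phi a) = W *m a.
Proof.
apply/colP => k; have Hk := rkhs_psi k.
rewrite samplesE ip_lincombl// [LHS]mxE [RHS]mxE; apply: eq_bigr => l _.
by rewrite samplesE [X in X * _]mxE [X in _ = X * _]mxE mulrC.
Qed.

Lemma ip_lincomb a b : ip H (lincomb phi a) (lincomb phi b) = (a^T *m W *m b) 0 0.
Proof. by rewrite ip_lincombl ?samples_lincomb ?mulmxA//; exact: rkhs_lincomb. Qed.

Lemma gram_psd : psd_mx W.
Proof.
split.
  apply/matrixP => k l; rewrite [LHS]mxE [LHS]mxE [RHS]mxE.
  by rewrite ipC//; exact: rkhs_psi.
by move=> a; rewrite -ip_lincomb; apply: ip_ge0; exact: rkhs_lincomb.
Qed.

(** Since $\|\sum_k(a_k-b_k)\psi_k\|^2 = (a-b)^TW(a-b)$, coefficients matter exactly modulo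
    the kernel of $W$; this makes [gram_iso] well defined and injective. *)
Lemma lincomb_eq a b : lincomb phi a = lincomb phi b <-> W *m a = W *m b.
Proof.
split=> [e|e]; first by rewrite -!samples_lincomb e.
apply/eqP; rewrite -subr_eq0 -lincombB; apply/eqP.
apply: (ip_eq0 (rkhs_lincomb _)).
by rewrite ip_lincomb -mulmxA mulmxBr e subrr mulmx0 mxE.
Qed.

Lemma gram_isoE a : gram_iso H phi (lincomb phi a) = W *m a.
Proof.
rewrite /gram_iso; apply/lincomb_eq; case: xgetP => [b _ //|none].
by case: (none a).
Qed.

Lemma gram_iso_invE a : gram_iso_inv H phi (W *m a) = lincomb phi a.
Proof.
rewrite /gram_iso_inv; case: xgetP => [f _ [[b _ <-]]|none].
  by rewrite gram_isoE => /lincomb_eq.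
by case: (none (lincomb phi a)); split; [exists a | exact: gram_isoE].
Qed.

End gram.

Section ridge.
Context {R : realType} {T : Type} {K : T -> T -> R} (H : rkhs K) {N M : nat}.
Variable phi : 'I_N -> 'I_M -> T -> R.
Hypothesis Hphi : forall i j, H (phi i j).
Variables (nu : R) (Y : 'cV[R]_(N * M)).
Hypothesis nu0 : 0 < nu.
Local Notation W := (gram H phi).
Local Notation risk f := (sqnorm (Y - samples H phi f) + nu * hnorm H f ^+ 2).
Local Notation ahat := (alpha_hat W Y nu).
Local Notation fhat := (lincomb phi ahat).
Let Wpsd := gram_psd Hphi.
Let Hfhat : H fhat. Proof. exact: rkhs_lincomb. Qed.

(** The normal equations $Y-W\hat\alpha = \nu\hat\alpha$ cancel the cross terms, so
    the risk is its value at the minimizer plus a positive definite form. *)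
Lemma ridge_risk_split f : H f ->
  risk f = risk fhat + sqnorm (samples H phi (f - fhat)) +
           nu * hnorm H (f - fhat) ^+ 2.
Proof.
move=> Hf; have Hg := rkhsB Hf Hfhat; set g := f - fhat in Hg *.
have fE : f = fhat + g by rewrite /g addrC subrK.
have -> : Y - samples H phi f = nu *: ahat - samples H phi g.
  rewrite /g samplesB// samples_lincomb// opprB addrA.
  by rewrite resolventE// [nu *: _ + _]addrC subrK.
have -> : Y - samples H phi fhat = nu *: ahat.
  by rewrite samples_lincomb// resolventE// opprB addrC subrK.
rewrite !sqr_hnorm// {1 2}fE ipDD// (ip_lincombl Hphi _ Hg) sqnormB.
rewrite [(_ *: _)^T]linearZ/= -scalemxAl [(_ *: _ : matrix _ _ _) _ _]mxE; ring.
Qed.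

Lemma ridge_min f : H f -> risk fhat <= risk f.
Proof.
move=> Hf; rewrite (ridge_risk_split Hf) -addrA lerDl addr_ge0 ?sqnorm_ge0//.
by rewrite mulr_ge0 ?sqr_ge0// ltW.
Qed.

Lemma ridge_min_unique f : H f -> risk f <= risk fhat -> f = fhat.
Proof.
move=> Hf; rewrite (ridge_risk_split Hf) -addrA gerDl => le0.
have Hg := rkhsB Hf Hfhat; apply/eqP; rewrite -subr_eq0; apply/eqP.
apply: (ip_eq0 Hg); move: le0; rewrite sqr_hnorm//.
have := sqnorm_ge0 (samples H phi (f - fhat)); have := ip_ge0 Hg => h1 h2 h3.
have : nu * ip H (f - fhat) (f - fhat) <= 0 by lra.
by rewrite pmulr_rle0// => h4; apply/eqP; rewrite eq_le h4 h1.
Qed.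

Lemma risk_lincomb a : risk (lincomb phi a) = emp_risk_vec W nu Y a.
Proof.
by rewrite samples_lincomb// sqr_hnorm ?ip_lincomb//; exact: rkhs_lincomb.
Qed.

Lemma emp_risk_vec_min : emp_risk_vec W nu Y ahat =
  nu * (Y^T *m invmx (W + nu%:M) *m Y) 0 0.
Proof.
rewrite /emp_risk_vec resolventE// opprB [X in sqnorm X]addrC subrK -mulmxA resolventE//.
have -> : sqnorm (nu *: ahat) = nu * (nu * sqnorm ahat).
  by rewrite /sqnorm !mulr_sumr; apply: eq_bigr => i _; rewrite mxE; ring.
rewrite mulmxBr -scalemxAr [(_ - _ : matrix _ _ _) _ _]mxE.
rewrite [(- _ : matrix _ _ _) _ _]mxE [(_ *: _ : matrix _ _ _) _ _]mxE dot_sqnorm.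
rewrite -[_ *m _ *m Y]mulmxA -/(alpha_hat W Y nu) (dotC Y); ring.
Qed.

End ridge.

(** * Affine images and convolutions of normal laws *)

Section normal_calculus.
Context {R : realType}.
Local Notation mu := (@lebesgue_measure R).
Implicit Types (m s t c b u v : R) (A : set R).

(** The density is the Radon-Nikodym derivative up to a null set, as both have the same
    integral over every measurable set. *)
Lemma integral_normal_prob m s (f : measurableTypeR R -> \bar R) :
  measurable_fun setT f -> (forall x, 0 <= f x)%E ->
  (\int[normal_prob m s]_x f x = \int[mu]_x (f x * (normal_pdf m s x)%:E))%E.
Proof.
move=> mf f0; have dom := normal_prob_dominates m s.
rewrite -(Radon_Nikodym_SigmaFinite.change_of_variables dom f0 measurableT mf).
have gi := Radon_Nikodym_SigmaFinite.f_integrable dom.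
have mp : measurable_fun setT (fun x => (normal_pdf m s x)%:E).
  by apply/measurable_EFinP; exact: measurable_normal_pdf.
apply: ae_eq_integral => //.
- by apply: emeasurable_funM => //; exact: measurable_int gi.
- exact: emeasurable_funM.
- apply: ae_eqe_mul2l; apply: integral_ae_eq => // E _ mE.
  by rewrite -Radon_Nikodym_SigmaFinite.f_integral.
Qed.

Lemma measurable_affine c b : measurable_fun setT (fun x : R => c * x + b).
Proof. by apply: measurable_funD => //; exact: measurable_funM. Qed.

(** By uniqueness of Lebesgue measure it is enough to compare lengths of intervals. *)
Lemma lebesgue_measure_affine c b A : c != 0 -> measurable A ->
  mu A = (`|c|%:E * mu ((fun x => (c * x + b)%R) @^-1` A))%E.
Proof.
move=> c0 mA.
have c'0 : 0 < `|c| by rewrite normr_gt0.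
pose g : measurableTypeR R -> measurableTypeR R := fun x => c * x + b.
have mg : measurable_fun [set: measurableTypeR R] g by exact: measurable_affine.
pose nu := mscale (NngNum (ltW c'0)) (pushforward mu g).
suff : mu A = nu mg A by [].
apply: lebesgue_measure_unique => // _ [[x y]] _ <- /=.
rewrite /nu /mscale/= /pushforward/=.
have [cp|cn] := ltP 0 c.
- have -> : g @^-1` `]x, y] = `](x - b) / c, (y - b) / c]%classic.
    apply/seteqP; split=> z; rewrite /g/= !in_itv/= ltr_pdivrMr// ler_pdivlMr//;
    by rewrite mulrC ltrBlDr lerBrDr.
  rewrite !lebesgue_measure_itv/= !lte_fin ltr_pM2r ?invr_gt0// ltrD2r.
  case: ifP => _; last by rewrite mule0.
  by rewrite -!EFinB -EFinM gtr0_norm//; congr EFin; field.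
- have {}cn : c < 0 by rewrite lt_neqAle c0.
  have -> : g @^-1` `]x, y] = `[(y - b) / c, (x - b) / c[%classic.
    apply/seteqP; split=> z; rewrite /g/= !in_itv/= ltr_ndivlMr// ler_ndivrMr//;
    by rewrite [z * c]mulrC ltrBlDr lerBrDr andbC.
  rewrite !lebesgue_measure_itv/= !lte_fin ltr_nM2r ?invr_lt0// ltrD2r.
  case: ifP => _; last by rewrite mule0.
  by rewrite -!EFinB -EFinM ltr0_norm//; congr EFin; field.
Qed.

Lemma integral_affine c b (f : measurableTypeR R -> \bar R) : c != 0 ->
  measurable_fun setT f -> (forall x, 0 <= f x)%E ->
  (\int[mu]_x f x = `|c|%:E * \int[mu]_x f (c * x + b)%R)%E.
Proof.
move=> c0 mf f0; have c'0 : 0 < `|c| by rewrite normr_gt0.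
pose g : measurableTypeR R -> measurableTypeR R := fun x => c * x + b.
have mg : measurable_fun [set: measurableTypeR R] g by exact: measurable_affine.
have := @ge0_integral_pushforward _ _ _ _ _ _ mg mu setT f measurableT mf (fun x _ => f0 x).
rewrite preimage_setT /comp /g => <-.
have := ge0_integral_mscale _ measurableT (NngNum (ltW c'0)) mf (fun x _ => f0 x).
move=> /= <-; apply: eq_measure_integral => A mA _.
exact: lebesgue_measure_affine.
Qed.

Lemma normal_pdf_affine m s c b x : s != 0 -> c != 0 ->
  `|c| * normal_pdf (c * m + b) (c * s) (c * x + b) = normal_pdf m s x.
Proof.
move=> s0 c0; rewrite !normal_pdfE ?mulf_neq0// mulrA; congr (_ * _).
  rewrite /normal_peak exprMn -mulrA -mulrnAr sqrtrM ?sqr_ge0// sqrtr_sqr invfM.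
  by rewrite mulrA divff ?mul1r// normr_eq0.
rewrite /normal_fun; congr expR; field.
by rewrite s0 c0.
Qed.

Lemma normal_prob_affine m s c b A : s != 0 -> c != 0 -> measurable A ->
  normal_prob m s ((fun x => c * x + b) @^-1` A) = normal_prob (c * m + b) (c * s) A.
Proof.
move=> s0 c0 mA; have mg := measurable_affine c b.
have mgA : measurable ((fun x : R => c * x + b) @^-1` A).
  by rewrite -[X in measurable X]setTI; exact: mg.
pose f := (fun x => (normal_pdf (c * m + b) (c * s) x)%:E) \_ A.
have mf : measurable_fun [set: measurableTypeR R] f.
  apply/(measurable_restrictT _ _).1 => //; apply/measurable_funTS/measurable_EFinP.
  exact: measurable_normal_pdf.
have f0 x : (0 <= f x)%E.
  by rewrite /f patchE; case: ifP => // _; rewrite lee_fin normal_pdf_ge0.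
rewrite /normal_prob integral_mkcond [RHS]integral_mkcond (integral_affine b c0 mf f0).
rewrite -ge0_integralZl//; last exact: measurableT_comp mf mg.
apply: eq_integral => x _; rewrite /f !patchE.
have -> : (c * x + b \in A) = (x \in (fun x : R => c * x + b) @^-1` A).
  by apply/idP/idP => /set_mem h; apply/mem_set.
by case: ifP => _; rewrite ?mule0// -EFinM normal_pdf_affine.
Qed.

(** Completing the square: the joint density of $(X, X+Y)$ is the density of the
    sum times a normal density in the first variable, which integrates to 1. *)
Lemma normal_pdf_mul s t x u : s != 0 -> t != 0 ->
  normal_pdf 0 s x * normal_pdf x t u =
  normal_pdf 0 (Num.sqrt (s ^+ 2 + t ^+ 2)) u *
  normal_pdf (s ^+ 2 / (s ^+ 2 + t ^+ 2) * u) (s * t / Num.sqrt (s ^+ 2 + t ^+ 2)) x.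
Proof.
move=> s0 t0; set r := Num.sqrt _.
have s2 : 0 < s ^+ 2 by rewrite exprn_even_gt0.
have t2 : 0 < t ^+ 2 by rewrite exprn_even_gt0.
have r2 : r ^+ 2 = s ^+ 2 + t ^+ 2 by rewrite sqr_sqrtr// addr_ge0// ltW.
have r0 : r != 0 by rewrite gt_eqF// sqrtr_gt0 addr_gt0.
have st0 : s ^+ 2 + t ^+ 2 != 0 by rewrite gt_eqF// addr_gt0.
rewrite !normal_pdfE ?mulf_neq0 ?invr_eq0// mulrACA [RHS]mulrACA; congr (_ * _).
  have pk (z : R) : 0 <= z ^+ 2 * pi *+ 2.
    by apply: mulrn_wge0; apply: mulr_ge0; [exact: sqr_ge0 | exact: pi_ge0].
  rewrite /normal_peak -!invfM -!sqrtrM//; congr ((Num.sqrt _)^-1).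
  by field.
rewrite /normal_fun -!expRD !exprMn !exprVn r2; congr expR; field.
by rewrite s0 t0 st0.
Qed.

Lemma normal_pdf_shift t x u : t != 0 -> normal_pdf x t u = normal_pdf 0 t (u - x).
Proof.
by move=> t0; rewrite !normal_pdfE// normal_fun_center.
Qed.

(** After the shift $u = x + y$ in the inner integral, Tonelli's theorem exposes the
    identity [normal_pdf_mul]. *)
Lemma normal_conv s t A : s != 0 -> t != 0 -> measurable A ->
  (normal_prob 0 s \x normal_prob 0 t)%E ((fun z : R * R => z.1 + z.2) @^-1` A) =
  normal_prob 0 (Num.sqrt (s ^+ 2 + t ^+ 2)) A.
Proof.
move=> s0 t0 mA; set r := Num.sqrt _.
pose B := (fun z : measurableTypeR R * measurableTypeR R => z.1 + z.2) @^-1` A.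
have mB : measurable B.
  rewrite /B -[X in measurable X]setTI.
  have : measurable_fun setT (fun z : measurableTypeR R * measurableTypeR R => z.1 + z.2).
    by apply: measurable_funD; [exact: measurable_fst | exact: measurable_snd].
  exact.
pose F (z : measurableTypeR R * measurableTypeR R) : \bar R :=
  (\1_A z.2 * (normal_pdf 0 s z.1 * normal_pdf 0 t (z.2 - z.1)))%:E.
have F0 z : (0 <= F z)%E by rewrite lee_fin !mulr_ge0 ?normal_pdf_ge0.
have mF : measurable_fun setT F.
  apply/measurable_EFinP; apply: measurable_funM; [|apply: measurable_funM].
  - by apply: measurableT_comp => //; exact: measurable_indic.
  - by apply: measurableT_comp => //; exact: measurable_normal_pdf.
  - apply: measurableT_comp; first exact: measurable_normal_pdf.
    exact: measurable_funB.
rewrite /product_measure1 integral_normal_prob//; last exact: measurable_fun_xsection.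
transitivity (\int[mu]_x \int[mu]_u F (x, u))%E.
  apply: eq_integral => x _; rewrite /F/=.
  have -> : normal_prob 0 t (xsection B x) = normal_prob x t A.
    have -> : normal_prob x t A = normal_prob (1 * 0 + x) (1 * t) A.
      by rewrite mulr0 add0r mul1r.
    rewrite -normal_prob_affine ?oner_eq0//; congr normal_prob; apply/seteqP; split => y.
      by move=> /xsectionP; rewrite /B/= mul1r addrC.
    by rewrite /= mul1r addrC => h; apply/xsectionP.
  rewrite /normal_prob integral_mkcond -ge0_integralZr//.
  - apply: eq_integral => u _; rewrite patchE indicE -normal_pdf_shift//.
    by case: ifP => _; rewrite ?mul0r ?mul0e// mul1r mulrC EFinM.
  - apply/(measurable_restrictT _ _).1 => //; apply/measurable_funTS/measurable_EFinP.
    exact: measurable_normal_pdf.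
  - by move=> u _; rewrite patchE; case: ifP => // _; rewrite lee_fin normal_pdf_ge0.
  - by rewrite lee_fin normal_pdf_ge0.
rewrite fubini_tonelli//= /normal_prob [RHS]integral_mkcond.
apply: eq_integral => u _; rewrite /F/= patchE indicE.
case: ifP => _; last by apply: integral0_eq => x _; rewrite mul0r.
under eq_integral do rewrite mul1r -normal_pdf_shift// normal_pdf_mul// EFinM.
rewrite ge0_integralZl ?integral_normal_pdf ?mule1//.
- by apply/measurable_EFinP; exact: measurable_normal_pdf.
- by move=> x _; rewrite lee_fin normal_pdf_ge0.
- by rewrite lee_fin normal_pdf_ge0.
Qed.

End normal_calculus.

Section normal_law.
Context {R : realType}.
Implicit Types (m s t c b u v : R) (A B : set R).

(** [normal_law] bundled as a probability, so that one may integrate against it and form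
    product measures with it. *)
Definition normal_law_prob m v : probability (measurableTypeR R) R :=
  if v == 0 then (@dirac _ (measurableTypeR R) m R : probability (measurableTypeR R) R)
  else (normal_prob m (Num.sqrt v) : probability (measurableTypeR R) R).

Lemma normal_law_probE m v : normal_law_prob m v = normal_law m v :> (set R -> \bar R).
Proof. by rewrite /normal_law_prob /normal_law; case: ifP. Qed.

Lemma normal_prob_sqr m s t A : s ^+ 2 = t ^+ 2 -> normal_prob m s A = normal_prob m t A.
Proof.
move=> st; rewrite /normal_prob; apply: eq_integral => x _.
rewrite /normal_pdf /normal_peak /normal_fun st.
by rewrite -(sqrf_eq0 s) st sqrf_eq0.
Qed.

Lemma dirac_preimage (f : R -> R) m A : (\d_m (f @^-1` A) = \d_(f m) A :> \bar R)%E.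
Proof.
by rewrite /dirac !indicE; congr (_%:R)%:E.
Qed.

Lemma normal_law_affine m v c b A : 0 <= v -> measurable A ->
  normal_law m v ((fun x => c * x + b) @^-1` A) = normal_law (c * m + b) (c ^+ 2 * v) A.
Proof.
move=> v0 mA; have [->|c0] := eqVneq c 0.
  have -> : (fun x : R => 0 * x + b) = cst b by apply/funext => x; rewrite mul0r add0r.
  rewrite expr0n/= !mul0r add0r {2}/normal_law eqxx preimage_cst -normal_law_probE.
  rewrite /dirac indicE; case: ifP => _.
    by rewrite probability_setT.
  by rewrite measure0.
have cv0 : (c ^+ 2 * v == 0) = (v == 0) by rewrite mulf_eq0 sqrf_eq0 (negbTE c0).
rewrite /normal_law cv0; have [_|vn0] := eqVneq v 0; first exact: dirac_preimage.
have sv0 : Num.sqrt v != 0 by rewrite gt_eqF// sqrtr_gt0 lt_def vn0.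
rewrite (normal_prob_affine _ _ sv0 c0 mA).
apply: normal_prob_sqr; rewrite exprMn (sqr_sqrtr v0) sqr_sqrtr//.
by rewrite mulr_ge0// sqr_ge0.
Qed.

Lemma normal_law_conv v u A : 0 <= v -> 0 <= u -> measurable A ->
  (normal_law_prob 0%R v \x normal_law_prob 0%R u)%E
    ((fun z : R * R => z.1 + z.2) @^-1` A) = normal_law 0 (v + u) A.
Proof.
move=> v0 u0 mA.
pose B := (fun z : measurableTypeR R * measurableTypeR R => z.1 + z.2) @^-1` A.
have mB : measurable B.
  rewrite /B -[X in measurable X]setTI.
  have : measurable_fun setT (fun z : measurableTypeR R * measurableTypeR R => z.1 + z.2).
    by apply: measurable_funD; [exact: measurable_fst | exact: measurable_snd].
  exact.
have [vE|vn0] := eqVneq v 0.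
  rewrite vE add0r /product_measure1 {1}/normal_law_prob eqxx integral_dirac//; last first.
    exact: measurable_fun_xsection.
  rewrite diracT mul1e normal_law_probE; congr normal_law.
  apply/seteqP; split => y; first by move=> /xsectionP; rewrite /= add0r.
  by move=> h; apply/xsectionP; rewrite /= add0r.
have [uE|un0] := eqVneq u 0.
  rewrite uE addr0 /product_measure1 -normal_law_probE -{2}(setIT A) -integral_indic//.
  apply: eq_integral => x _.
  rewrite /normal_law_prob eqxx /= /dirac !indicE; congr ((nat_of_bool _)%:R%:E).
  apply/idP/idP => /set_mem h; apply/mem_set.
    by move/xsectionP : h; rewrite /= addr0.
  by apply/xsectionP; rewrite /= addr0.
rewrite /normal_law paddr_eq0// (negbTE vn0)/= /normal_law_prob (negbTE vn0) (negbTE un0).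
have sv0 : Num.sqrt v != 0 by rewrite gt_eqF// sqrtr_gt0 lt_def vn0.
have su0 : Num.sqrt u != 0 by rewrite gt_eqF// sqrtr_gt0 lt_def un0.
by rewrite (normal_conv sv0 su0 mA) (sqr_sqrtr v0) (sqr_sqrtr u0).
Qed.

End normal_law.

(** * Sums of independent normal variables *)

Lemma measurable_preimage (d : measure_display) (T : measurableType d)
    (R : realType) (X : T -> R) (A : set R) :
  measurable_fun setT X -> measurable A -> measurable (X @^-1` A).
Proof. by move=> mX mA; rewrite -[_ @^-1` _]setTI; exact: mX. Qed.

Section independent_sum.
Context {d : measure_display} {Omega : measurableType d} {R : realType}.
Variable P : probability Omega R.
Implicit Types (X Z : Omega -> R) (E : set Omega).

(** Independence of $Z$ and $X$ is required relatively to the event $E$, which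
    stands for the variables still to be added to the sum. *)
Lemma normal_add_indep X Z E v u : 0 <= v -> 0 <= u ->
  measurable_fun setT X -> measurable_fun setT Z -> measurable E ->
  (forall A B, measurable A -> measurable B ->
    P (Z @^-1` A `&` (X @^-1` B `&` E)) = (normal_law 0 v A * (normal_law 0 u B * P E))%E) ->
  forall A, measurable A ->
    P ((fun w => Z w + X w) @^-1` A `&` E) = (normal_law 0 (v + u) A * P E)%E.
Proof.
move=> v0 u0 mX mZ mE ind A mA.
pose p := NngNum (fine_ge0 (measure_ge0 P E)).
have pE : (p%:num%:E = P E)%E by rewrite /= fineK// fin_num_measure.
pose ZX w : measurableTypeR R * measurableTypeR R := (Z w, X w).
have mZX : measurable_fun setT ZX by exact: measurable_fun_pair.
pose B := (fun z : measurableTypeR R * measurableTypeR R => z.1 + z.2) @^-1` A.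
have mB : measurable B.
  rewrite /B -[X in measurable X]setTI.
  have : measurable_fun setT (fun z : measurableTypeR R * measurableTypeR R => z.1 + z.2).
    by apply: measurable_funD; [exact: measurable_fst | exact: measurable_snd].
  exact.
(* The factor P E is put into the first marginal, so that the uniqueness of the product
   measure identifies the law of (Z, X) restricted to E. *)
have prodE : (mscale p (normal_law_prob 0 v) \x normal_law_prob 0 u)%E B =
    P (ZX @^-1` B `&` E).
  apply: (product_measure_unique (m' := pushforward (mrestr P mE) ZX)) => //.
  move=> A1 A2 mA1 mA2.
  transitivity (P (Z @^-1` A1 `&` (X @^-1` A2 `&` E))); first by rewrite setIA.
  rewrite ind//= /mscale pE -!normal_law_probE.
  by rewrite [X in (_ * X)%E = _]muleC muleCA muleA.
transitivity (P (ZX @^-1` B `&` E)); first by [].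
rewrite -prodE /product_measure1 ge0_integral_mscale//; last exact: measurable_fun_xsection.
by rewrite pE muleC; congr (_ * _)%E; exact: normal_law_conv.
Qed.

Lemma has_law_affine X m v c b : 0 <= v -> has_law P X (normal_law m v) ->
  has_law P (fun w => c * X w + b) (normal_law (c * m + b) (c ^+ 2 * v)).
Proof.
move=> v0 [mX lX]; split.
  by apply: measurable_funD => //; exact: measurable_funM.
move=> B mB; rewrite -normal_law_affine// -lX//.
exact: (measurable_preimage (measurable_affine c b)).
Qed.

(** The induction adds the variables one at a time; those not yet added stay in the
    family $J$, so that only the product rule on cylinder events is ever used. *)
Lemma normal_sum_indep (I : finType) (X : I -> Omega -> R) (v : R) (c : I -> R)
    (s : seq I) (J : {set I}) (B : I -> set R) (A : set R) : 0 <= v ->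
  (forall i, has_law P (X i) (normal_law 0 v)) -> mutually_independent P X ->
  uniq s -> (forall i, i \in s -> i \notin J) ->
  (forall i, measurable (B i)) -> measurable A ->
  P ((fun w => \sum_(i <- s) c i * X i w) @^-1` A `&`
     \bigcap_(i in [set` J]) (X i @^-1` B i)) =
  (normal_law 0 (\sum_(i <- s) c i ^+ 2 * v) A *
   P (\bigcap_(i in [set` J]) (X i @^-1` B i)))%E.
Proof.
move=> v0 lX iX; elim: s J B A => [|i s IH] J B A.
  move=> _ _ mB mA; rewrite big_nil /normal_law eqxx.
  have -> : (fun w => \sum_(i <- [::]) c i * X i w) = cst 0.
    by apply/funext => w; rewrite big_nil.
  rewrite preimage_cst /dirac indicE; case: ifP => _.
    by rewrite setTI mul1e.
  by rewrite set0I measure0 mul0e.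
move=> /andP[is_ us] sJ mB mA; rewrite big_cons addrC.
have -> : (fun w => \sum_(j <- i :: s) c j * X j w) =
    (fun w => \sum_(j <- s) c j * X j w + c i * X i w).
  by apply/funext => w; rewrite big_cons addrC.
have mX j : measurable_fun setT (X j) by case: (lX j).
have iJ : i \notin J by apply: sJ; rewrite mem_head.
have [_ lci] := has_law_affine (c i) 0 v0 (lX i).
have mci : measurable_fun setT (fun w => c i * X i w) by exact: measurable_funM.
apply: normal_add_indep => //.
- by apply: sumr_ge0 => j _; rewrite mulr_ge0 ?sqr_ge0.
- by rewrite mulr_ge0 ?sqr_ge0.
- apply: measurable_sum => j; exact: measurable_funM.
- by apply: fin_bigcap_measurable => // j _; exact: measurable_preimage.
move=> A1 A2 mA1 mA2.
(* X i is absorbed into the cylinder event, to which the induction hypothesis applies. *)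
pose A2' := (fun x => c i * x) @^-1` A2.
have mA2' : measurable A2'.
  rewrite -[A2']setTI; apply: (@measurable_funM _ _ _ setT (cst (c i)) id) => //.
pose B' j := if j == i then A2' else B j.
have mB' j : measurable (B' j) by rewrite /B'; case: ifP.
have capE : (fun w => c i * X i w) @^-1` A2 `&` \bigcap_(j in [set` J]) (X j @^-1` B j) =
    \bigcap_(j in [set` (i |: J)%SET]) (X j @^-1` B' j).
  apply/seteqP; split => w.
    move=> [h1 h2] j /=; rewrite in_setU1 /B'; case: eqP => [-> //|_] /= jJ.
    exact: h2.
  move=> h; split.
    by have := h i; rewrite /= setU11 /B' eqxx; exact.
  move=> j jJ; have := h j; rewrite /= in_setU1 (_ : j \in J)// orbT /B'.
  case: eqP => [ji|_]; last exact.
  by move: iJ; rewrite -ji jJ.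
rewrite capE IH//; last first.
  move=> j js; rewrite in_setU1 negb_or sJ ?andbT; last by rewrite in_cons js orbT.
  by apply: contra is_ => /eqP <-.
congr (_ * _)%E; rewrite !iX// big_setU1//=; congr (_ * _)%E.
  rewrite /B' eqxx; have := lci A2 mA2; rewrite mulr0 addr0 => <-.
  by rewrite (_ : (fun w => c i * X i w + 0) = (fun w => c i * X i w))//;
    apply/funext => w; rewrite addr0.
apply: eq_bigr => j jJ; rewrite /B'; case: eqP => // ji.
by move: iJ; rewrite -ji jJ.
Qed.

End independent_sum.

(** * Moments of normal laws *)

Section gauss_second_moment.
Context {R : realType}.
Local Notation mu := (@lebesgue_measure R).
Local Notation G := (@gauss_integral_proof.integral0_gauss R).

Lemma continuous_sqr_gauss : continuous (fun x : R => x ^+ 2 * gauss_fun x).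
Proof.
move=> x; apply: (@continuousM _ _ (fun x : R => x ^+ 2) gauss_fun).
  exact: exprn_continuous.
exact: continuous_gauss_fun.
Qed.

Lemma cvg_integral0_gauss : G x @[x --> +oo] --> Num.sqrt pi / 2.
Proof.
have : Num.sqrt (G x ^+ 2) @[x --> +oo] --> Num.sqrt (pi / 4 : R).
  apply: continuous_cvg; first exact: sqrt_continuous.
  exact: gauss_integral_proof.cvg_integral0_gauss_sqr.
have -> : Num.sqrt (pi / 4 : R) = Num.sqrt pi / 2.
  rewrite sqrtrM ?pi_ge0// sqrtrV// (_ : 4 = 2 ^+ 2); last by rewrite expr2 -natrM.
  by rewrite sqrtr_sqr ger0_norm.
rewrite (_ : (fun _ => Num.sqrt _) = G)//; apply/funext => r.
by rewrite sqrtr_sqr ger0_norm// gauss_integral_proof.integral0_gauss_ge0.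
Qed.

Lemma cvg_mul_gauss : x * gauss_fun x @[x --> +oo] --> (0 : R).
Proof.
apply/cvgrPdist_lt => e e0; near=> x.
have x0 : 0 < x by near: x; exact: nbhs_pinfty_gt.
rewrite sub0r normrN ger0_norm ?mulr_ge0 ?gauss_fun_ge0 ?ltW//.
have xe : e^-1 < x by near: x; apply: nbhs_pinfty_gt; rewrite num_real.
apply: (@le_lt_trans _ _ (x * (x ^+ 2)^-1)).
  rewrite (ler_wpM2l (ltW x0))// /gauss_fun expRN lef_pV2 ?posrE ?expR_gt0 ?exprn_gt0//.
  by apply: le_trans (expR_ge1Dx _); rewrite lerDr ler01.
rewrite expr2 invfM mulrA divff ?gt_eqF// mul1r.
by rewrite -[ltRHS]invrK ltf_pV2// posrE// invr_gt0.
Unshelve. all: by end_near. Qed.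

Lemma is_derive_gauss (x : R) : is_derive x 1 (@gauss_fun R) (- 2 * x * gauss_fun x).
Proof.
have dN := is_deriveN (is_deriveX 2 (is_derive_id x (1 : R))).
have -> : @gauss_fun R = expR \o - (id ^+ 2) by apply/funext => y; rewrite /= !fctE.
apply: (is_derive_eq (is_derive1_comp (is_derive_expR _) dN)).
by rewrite /= !fctE /GRing.scale/= mulr1 expr1 mulrC !mulNr.
Qed.

Lemma is_derive_integral0_gauss (x : R) : 0 < x -> is_derive x 1 G (gauss_fun x).
Proof.
move=> x0; have xx1 : x < x + 1 by rewrite ltrDl.
have intg : mu.-integrable `[0, x + 1] (EFin \o @gauss_fun R).
  apply: continuous_compact_integrable; first exact: segment_compact.
  by apply: continuous_subspaceT; exact: continuous_gauss_fun.
have [d1 d2] := continuous_FTC1_closed xx1 intg x0 (@continuous_gauss_fun R x).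
by apply: (DeriveDef d1); rewrite -derive1E d2.
Qed.

(** Integration by parts: $\frac12(\int_0^x e^{-t^2}dt - x e^{-x^2})$ is an antiderivative
    of $x^2e^{-x^2}$ on the half line. *)
Lemma integral_sqr_gauss :
  (\int[mu]_x (x ^+ 2 * gauss_fun x)%:E)%E = (Num.sqrt pi / 2)%:E.
Proof.
have ge0 (x : R) : 0 <= x ^+ 2 * gauss_fun x by rewrite mulr_ge0 ?sqr_ge0 ?gauss_fun_ge0.
rewrite ge0_symfun_integralT//=; last 2 first.
- exact: continuous_sqr_gauss.
- by move=> x/=; rewrite /gauss_fun sqrrN.
rewrite (_ : [set x | _] = `[0, +oo[%classic); last first.
  by apply/seteqP; split => x/=; rewrite in_itv/= andbT.
pose F := 2^-1 \*: (G - id * gauss_fun).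
have dF (x : R) : 0 < x -> is_derive x 1 F (x ^+ 2 * gauss_fun x).
  move=> x0.
  have dG := is_derive_integral0_gauss x0; have dg := is_derive_gauss x.
  apply: (is_derive_eq
    (is_deriveZ 2^-1 (is_deriveB dG (is_deriveM (is_derive_id x (1 : R)) dg)))).
  by rewrite /GRing.scale/=; field.
have F0 : F 0 = 0.
  rewrite /F/= !fctE mul0r subr0 /G /GRing.scale/= set_itv1.
  by rewrite /Rintegral integral_set1// mulr0.
rewrite (@ge0_continuous_FTC2y _ _ F 0 (Num.sqrt pi / 4)).
- by rewrite F0 -EFinB -EFinM; congr EFin; field.
- by [].
- exact/continuous_subspaceT/continuous_sqr_gauss.
- have -> : Num.sqrt pi / 4 = 2^-1 * (Num.sqrt pi / 2 - 0) :> R by field.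
  apply: cvgZr; apply: cvgB; first exact: cvg_integral0_gauss.
  exact: cvg_mul_gauss.
- by move=> x /dF [].
- have G0 : G x @[x --> (0 : R)] --> (0 : R).
    apply: (parameterized_integral_cvg_left (@ltr01 R)).
    apply: continuous_compact_integrable; first exact: segment_compact.
    by apply: continuous_subspaceT; exact: continuous_gauss_fun.
  have xg0 : x * gauss_fun x @[x --> (0 : R)] --> (0 * gauss_fun 0 : R).
    by apply: cvgM; [exact: cvg_id | exact: continuous_gauss_fun].
  have F'0 : 2^-1 * (G x - x * gauss_fun x) @[x --> (0 : R)] -->
      (2^-1 * (0 - 0 * gauss_fun 0) : R).
    by apply: cvgMr; exact: cvgB.
  rewrite F0; apply: cvg_at_right_filter.
  by move: F'0; rewrite mul0r subr0 mulr0.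
- by move=> x; rewrite in_itv/= andbT => /dF [? <-]; rewrite derive1E.
Qed.

End gauss_second_moment.

Section normal_moments.
Context {d : measure_display} {Omega : measurableType d} {R : realType}.
Variable P : probability Omega R.
Implicit Types (X Z : Omega -> R) (m v : R).

Lemma mem_Lfun2 X : measurable_fun setT X -> (\int[P]_w (X w ^+ 2)%:E < +oo)%E ->
  X \in Lfun P 2%:E.
Proof.
move=> mX X2; rewrite inE; apply/andP; split; rewrite inE//=.
rewrite /finite_norm unlock poweR_lty//.
rewrite (eq_integral (fun w => (X w ^+ 2)%:E)) => [//|w _ /=].
by rewrite powR_mulrn// -normrX ger0_norm ?sqr_ge0.
Qed.

Lemma Lfun21 X : X \in Lfun P 2%:E -> X \in Lfun P 1.
Proof. by apply: Lfun_subset12; rewrite fin_num_measure. Qed.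

Lemma ge0_integral_law X m v (f : measurableTypeR R -> \bar R) :
  has_law P X (normal_law m v) -> measurable_fun setT f -> (forall x, 0 <= f x)%E ->
  (\int[P]_w f (X w) = \int[normal_law_prob m v]_x f x)%E.
Proof.
move=> [mX lX] mf f0; pose X' : Omega -> measurableTypeR R := X.
have mX' : measurable_fun setT X' by exact: mX.
have := @ge0_integral_pushforward _ _ _ _ _ _ mX' P setT f measurableT mf (fun x _ => f0 x).
rewrite preimage_setT => <-.
apply: eq_measure_integral => A mA _; transitivity (normal_law m v A).
  by rewrite -lX.
by rewrite -normal_law_probE.
Qed.

Lemma integral_law X m v : has_law P X (normal_law m v) -> X \in Lfun P 1 ->
  (\int[P]_w (X w)%:E = \int[normal_law_prob m v]_x x%:E)%E.
Proof.
move=> [mX lX] /Lfun1_integrable iX; pose X' : Omega -> measurableTypeR R := X.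
have mX' : measurable_fun setT X' by exact: mX.
have mE : measurable_fun setT (EFin : measurableTypeR R -> \bar R) by exact/measurable_EFinP.
have := @integral_pushforward _ _ _ _ _ _ mX' P setT EFin mE.
rewrite preimage_setT => <- //.
apply: eq_measure_integral => A mA _; transitivity (normal_law m v A).
  by rewrite -lX.
by rewrite -normal_law_probE.
Qed.

(** At variance 1/2 the density is $e^{-x^2}/\sqrt\pi$. *)
Lemma integral_sqr_normal_half :
  (\int[normal_law_prob 0%R (2^-1 : R)]_x (x ^+ 2)%:E = (2^-1 : R)%:E)%E.
Proof.
rewrite /normal_law_prob invr_eq0 pnatr_eq0/=.
have s2 : Num.sqrt (2^-1 : R) ^+ 2 = 2^-1 by rewrite sqr_sqrtr// invr_ge0.
have s0 : Num.sqrt (2^-1 : R) != 0 by rewrite gt_eqF// sqrtr_gt0 invr_gt0.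
rewrite integral_normal_prob//; last 2 first.
- by apply/measurable_EFinP; exact: measurable_funX.
- by move=> x; rewrite lee_fin sqr_ge0.
transitivity (\int[lebesgue_measure]_x (((Num.sqrt (pi : R))^-1)%:E * (x ^+ 2 * gauss_fun x)%:E))%E.
  apply: eq_integral => x _; rewrite -!EFinM normal_pdfE// /normal_peak /normal_fun.
  have -> : Num.sqrt (2^-1 : R) ^+ 2 * pi *+ 2 = pi by rewrite s2; field.
  have -> : Num.sqrt (2^-1 : R) ^+ 2 *+ 2 = 1 by rewrite s2; field.
  by rewrite subr0 divr1 mulrCA.
rewrite ge0_integralZl//; last 2 first.
- apply/measurable_EFinP; apply: measurable_funM; first exact: measurable_funX.
  exact: measurable_gauss_fun.
- by move=> x _; rewrite lee_fin mulr_ge0 ?sqr_ge0 ?gauss_fun_ge0.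
rewrite integral_sqr_gauss -EFinM mulrA mulVf ?mul1r//.
by rewrite gt_eqF// sqrtr_gt0 pi_gt0.
Qed.

Let half_ge0 : 0 <= (2^-1 : R). Proof. by rewrite invr_ge0. Qed.

Lemma integral_sqr_half Z : has_law P Z (normal_law 0 2^-1) ->
  (\int[P]_w (Z w ^+ 2)%:E = (2^-1 : R)%:E)%E.
Proof.
move=> lZ; rewrite -integral_sqr_normal_half.
apply: (ge0_integral_law (f := fun x => (x ^+ 2)%:E) lZ).
  by apply/measurable_EFinP; exact: measurable_funX.
by move=> x; rewrite lee_fin sqr_ge0.
Qed.

Lemma Lfun2_half Z : has_law P Z (normal_law 0 2^-1) -> Z \in Lfun P 2%:E.
Proof.
by move=> lZ; apply: mem_Lfun2; [case: lZ | rewrite integral_sqr_half// ltry].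
Qed.

(** $Z$ and $-Z$ have the same law. *)
Lemma expectation_half Z : has_law P Z (normal_law 0 2^-1) -> ('E_P[Z] = 0)%E.
Proof.
move=> lZ; have Z1 := Lfun21 (Lfun2_half lZ).
have lN : has_law P (\- Z) (normal_law 0 2^-1).
  have := has_law_affine (-1) 0 half_ge0 lZ.
  rewrite mulr0 addr0 sqrrN expr1n mul1r.
  by rewrite (_ : (fun w => -1 * Z w + 0) = \- Z)//; apply/funext => w; rewrite mulN1r addr0.
have N1 : \- Z \in Lfun P 1 by rewrite rpredN.
have e : ('E_P[\- Z] = 'E_P[Z])%E by rewrite unlock !(integral_law (m := 0) (v := 2^-1)).
have : ('E_P[\- Z] = - 'E_P[Z])%E.
  by rewrite unlock -integralN//; exact/integrable_add_def/Lfun1_integrable.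
rewrite e; have := expectation_fin_num Z1.
case: ('E_P[Z])%E => // r _ [] h; congr EFin; lra.
Qed.

Lemma normal_law_moments X m v : 0 <= v -> has_law P X (normal_law m v) ->
  [/\ X \in Lfun P 2%:E, 'E_P[X] = m%:E & 'E_P[X ^+ 2] = (m ^+ 2 + v)%:E]%E.
Proof.
move=> v0 lX; have [vE|vn0] := eqVneq v 0.
  have X2 : (\int[P]_w (X w ^+ 2)%:E = (m ^+ 2)%:E)%E.
    rewrite (ge0_integral_law (f := fun x => (x ^+ 2)%:E) lX)//.
    - rewrite vE /normal_law_prob eqxx integral_dirac//= ?diracT ?mul1e//.
      by apply/measurable_EFinP; exact: measurable_funX.
    - by apply/measurable_EFinP; exact: measurable_funX.
    - by move=> x; rewrite lee_fin sqr_ge0.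
  have L2 : X \in Lfun P 2%:E by apply: mem_Lfun2; [case: lX | rewrite X2 ltry].
  split => //; rewrite unlock.
  - rewrite (integral_law lX (Lfun21 L2)) vE /normal_law_prob eqxx integral_dirac//.
    by rewrite diracT mul1e.
  - by rewrite vE addr0.
(* With this c, the standardized variable Z has variance 1/2. *)
pose c := Num.sqrt (2 * v); pose Z w := c^-1 * X w + - (c^-1 * m).
have c0 : c != 0 by rewrite gt_eqF// sqrtr_gt0 mulr_gt0// lt_def vn0.
have c2 : c ^+ 2 = 2 * v by rewrite sqr_sqrtr// mulr_ge0.
have vE : c^-1 ^+ 2 * v = 2^-1 by rewrite exprVn c2; field.
have lZ : has_law P Z (normal_law 0 2^-1).
  by have := has_law_affine c^-1 (- (c^-1 * m)) v0 lX; rewrite subrr vE.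
have Z2 := Lfun2_half lZ; have Z1 := Lfun21 Z2.
have XE : X = c \o* Z \+ cst m.
  by apply/funext => w; rewrite /Z/=; field; exact: c0.
have cZ2 : c \o* Z \in Lfun P 2%:E by apply: Lfun_scale => //; rewrite ler1n.
have L2 : X \in Lfun P 2%:E.
  rewrite XE; apply: rpredD => [|?|?]; last exact: Lfun_cst.
    by rewrite lee_fin ler1n.
  exact: cZ2.
split => //.
  rewrite XE expectationD ?(Lfun21 cZ2)// ?Lfun_cst//.
  by rewrite expectationZl// expectation_half// mule0 add0e expectation_cst.
have sqrZ : Z ^+ 2 \in Lfun P 1 by exact: (Lfun2_mul_Lfun1 Z2 Z2).
have -> : X ^+ 2 = (c ^+ 2 \o* (Z ^+ 2) \+ (2 * c * m) \o* Z) \+ cst (m ^+ 2).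
  by apply/funext => w; rewrite {1}XE !fctE/=; ring.
have s1 : c ^+ 2 \o* (Z ^+ 2) \in Lfun P 1 by apply: Lfun_scale.
have s2 : (2 * c * m) \o* Z \in Lfun P 1 by apply: Lfun_scale.
rewrite expectationD ?rpredD ?Lfun_cst//.
rewrite expectationD// (expectationZl _ sqrZ) (expectationZl _ Z1) (expectation_half lZ).
rewrite mule0 adde0 expectation_cst.
have -> : ('E_P[Z ^+ 2] = (2^-1 : R)%:E)%E by rewrite -(integral_sqr_half lZ) unlock.
by rewrite -EFinM -EFinD c2; congr EFin; field.
Qed.

End normal_moments.

(** * Affine images of Gaussian noise *)

Section gaussian_noise.
Context {d : measure_display} {Omega : measurableType d} {R : realType}.
Variables (P : probability Omega R) (N M : nat) (sigma : R).
Variable eps : 'I_N -> 'I_M -> Omega -> R.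
Hypothesis eps_law : forall i j, has_law P (eps i j) (normal_law 0 (sigma ^+ 2)).
Hypothesis eps_indep :
  mutually_independent P (fun k : 'I_N * 'I_M => eps k.1 k.2).
Implicit Types (a b c : 'cV[R]_(N * M)) (m : R).

Definition noise w : 'cV[R]_(N * M) := vec (fun i j => eps i j w).
Local Notation L c := (fun w => (c^T *m noise w) 0 0).

(** A linear functional of the noise is a sum of independent normal variables. *)
Lemma noise_law c m :
  has_law P (fun w => L c w + m) (normal_law m (sigma ^+ 2 * sqnorm c)).
Proof.
pose c' (p : 'I_N * 'I_M) := c (mxvec_index p.1 p.2) 0.
pose X (p : 'I_N * 'I_M) := eps p.1 p.2.
have LE : L c = fun w => \sum_(p <- index_enum _) c' p * X p w.
  apply/funext => w; rewrite mxE -(sum_mxvec_index (fun k => c^T 0 k * noise w k 0)).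
  rewrite pair_bigA/=; apply: eq_bigr => -[i j] _ /=.
  by rewrite vecE [X in X * _]mxE.
have s2 : 0 <= sigma ^+ 2 by exact: sqr_ge0.
have vE : sigma ^+ 2 * sqnorm c = \sum_(p <- index_enum _) c' p ^+ 2 * sigma ^+ 2.
  rewrite /sqnorm -(sum_mxvec_index (fun k => c k 0 ^+ 2)) pair_bigA/= mulr_sumr.
  by apply: eq_bigr => p _; rewrite mulrC.
have lX p : has_law P (X p) (normal_law 0 (sigma ^+ 2)) by exact: eps_law.
have law0 : has_law P (L c) (normal_law 0 (sigma ^+ 2 * sqnorm c)).
  rewrite LE vE; split.
    by apply: measurable_sum => p; apply: measurable_funM => //; case: (lX p).
  move=> A mA.
  have := normal_sum_indep c' (J := finset.set0) (B := fun=> setT) s2 lX eps_indep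
    (index_enum_uniq _) (fun p _ => negbT (finset.in_set0 p)) (fun=> measurableT) mA.
  rewrite (_ : \bigcap_(i in _) _ = setT); last by apply/seteqP; split.
  by rewrite setIT probability_setT mule1.
have v0 : 0 <= sigma ^+ 2 * sqnorm c by rewrite mulr_ge0 ?sqnorm_ge0.
have := has_law_affine 1 m v0 law0; rewrite mulr0 add0r expr1n mul1r.
by under eq_fun do rewrite mul1r.
Qed.

Lemma noise_moments c : [/\ L c \in Lfun P 2%:E, 'E_P[L c] = 0%:E
  & 'E_P[(L c ^+ 2)%R] = (sigma ^+ 2 * sqnorm c)%:E]%E.
Proof.
have v0 : 0 <= sigma ^+ 2 * sqnorm c by rewrite mulr_ge0 ?sqnorm_ge0 ?sqr_ge0.
have lc : has_law P (L c) (normal_law 0 (sigma ^+ 2 * sqnorm c)).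
  by have := noise_law c 0; under eq_fun do rewrite addr0.
have [h1 h2 h3] := normal_law_moments v0 lc.
by rewrite h3 expr0n/= add0r.
Qed.

(** Polarization of the variance formula. *)
Lemma noise_cov a b :
  ('E_P[(fun w => L a w * L b w)%R] = (sigma ^+ 2 * (a^T *m b) 0 0)%:E)%E.
Proof.
have [a2 _ Ea] := noise_moments a; have [b2 _ Eb] := noise_moments b.
have [_ _ Eab] := noise_moments (a + b).
have ab1 := Lfun2_mul_Lfun1 a2 b2.
have aa1 := Lfun2_mul_Lfun1 a2 a2; have bb1 := Lfun2_mul_Lfun1 b2 b2.
have ab1' : 2 \o* (L a \* L b) \in Lfun P 1 by exact: Lfun_scale.
have LE : L (a + b) ^+ 2 = ((L a \* L a) \+ 2 \o* (L a \* L b)) \+ (L b \* L b).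
  apply/funext => w; rewrite !fctE/= [(_ + _)^T]raddfD/= mulmxDl.
  by rewrite [(_ + _ : matrix _ _ _) _ _]mxE; ring.
move: Eab; rewrite LE expectationD//; last exact: rpredD.
rewrite expectationD// (expectationZl _ ab1).
rewrite (_ : 'E_P[(L a \* L a)%R] = (sigma ^+ 2 * sqnorm a)%:E)%E; last by rewrite -Ea.
rewrite (_ : 'E_P[(L b \* L b)%R] = (sigma ^+ 2 * sqnorm b)%:E)%E; last by rewrite -Eb.
have := expectation_fin_num ab1.
rewrite (_ : L a \* L b = (fun w => L a w * L b w))//.
case: ('E_P[_])%E => // r _; rewrite -EFinM -!EFinD => -[] h; congr EFin.
have := sqnormB a (- b); rewrite opprK mulmxN [(- _ : matrix _ _ _) _ _]mxE.
have -> : sqnorm (- b) = sqnorm b.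
  by rewrite /sqnorm; apply: eq_bigr => i _; rewrite mxE sqrrN.
move=> h2; move: h; rewrite h2; lra.
Qed.

Lemma noise_affine_law (k : nat) (m : 'cV[R]_k) (A : 'M[R]_(k, N * M)) (a : 'cV[R]_k) :
  has_law P (fun w => (a^T *m (m + A *m noise w)) 0 0)
    (normal_law ((a^T *m m) 0 0) (sigma ^+ 2 * sqnorm (A^T *m a))).
Proof.
have := noise_law (A^T *m a) ((a^T *m m) 0 0).
rewrite (_ : (fun w => L (A^T *m a) w + _) =
  (fun w => (a^T *m (m + A *m noise w)) 0 0))//.
apply/funext => w; rewrite trmx_mul trmxK mulmxDr -mulmxA.
by rewrite [(_ + _ : matrix _ _ _) _ _]mxE addrC.
Qed.

Lemma gaussian_vector_affine (k : nat) (m : 'cV[R]_k) (A : 'M[R]_(k, N * M)) :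
  gaussian_vector P (fun w => m + A *m noise w) m (sigma ^+ 2 *: (A *m A^T)).
Proof.
have rowE i w : (m + A *m noise w) i 0 = (((row i A)^T)^T *m noise w) 0 0 + m i 0.
  by rewrite trmxK -row_mul !mxE addrC; congr (_ + _); apply: eq_bigr.
have EX i : ('E_P[(fun w => (m + A *m noise w) i 0)%R] = (m i 0)%:E)%E.
  under eq_fun do rewrite rowE.
  have v0 : 0 <= sigma ^+ 2 * sqnorm (row i A)^T by rewrite mulr_ge0 ?sqnorm_ge0 ?sqr_ge0.
  by have [] := normal_law_moments v0 (noise_law (row i A)^T (m i 0)).
split => //.
- move=> a; exists ((a^T *m m) 0 0), (sigma ^+ 2 * sqnorm (A^T *m a)).
  by split; [rewrite mulr_ge0 ?sqnorm_ge0 ?sqr_ge0 | exact: noise_affine_law].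
- move=> i j; rewrite unlock !EX/=.
  transitivity ('E_P[(fun w => L (row i A)^T w * L (row j A)^T w)%R])%E.
    congr expectation; apply/funext => w; rewrite !fctE/=.
    by rewrite !rowE !addrK.
  rewrite noise_cov trmxK; congr EFin; rewrite !mxE; congr (_ * _).
  by apply: eq_bigr => l _; rewrite !mxE.
Qed.

(** Pairing a random combination with $\sum_k b_k\psi_k$ is the functional $Wb$ of its
    coefficients, which brings everything back to [noise_affine_law] and [noise_cov]. *)
Lemma gaussian_element_affine {T : Type} {K : T -> T -> R} (H : rkhs K)
    (phi : 'I_N -> 'I_M -> T -> R) (Hphi : forall i j, H (phi i j))
    (m : 'cV[R]_(N * M)) (A : 'M[R]_(N * M)) :
  gaussian_element P H (fspan phi) (fun w => lincomb phi (m + A *m noise w))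
    (lincomb phi m)
    (fun h => lincomb phi (sigma ^+ 2 *: (A *m A^T *m gram_iso H phi h))).
Proof.
have [Wsym _] := gram_psd Hphi; set W := gram H phi in Wsym.
have ipE (a b : 'cV[R]_(N * M)) :
    ip H (lincomb phi a) (lincomb phi b) = ((W *m b)^T *m a) 0 0.
  by rewrite ip_lincomb// -mulmxA dotC.
have v0 c : 0 <= sigma ^+ 2 * sqnorm c by rewrite mulr_ge0 ?sqnorm_ge0 ?sqr_ge0.
have spanL a : fspan phi (lincomb phi a) by exists a.
split => //.
- move=> h [b _ <-]; exists (((W *m b)^T *m m) 0 0), (sigma ^+ 2 * sqnorm (A^T *m (W *m b))).
  split=> //; under eq_fun do rewrite ipE; exact: noise_affine_law.
- split=> // h [b _ <-]; under eq_fun do rewrite ipE; rewrite ipE.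
  by have [] := normal_law_moments (v0 _) (noise_affine_law m A (W *m b)).
- move=> h [b _ <-]; split=> // g [a _ <-]; rewrite gram_isoE// -/W.
  have LE c w : ip H (lincomb phi (m + A *m noise w) - lincomb phi m) (lincomb phi c)
      = L (A^T *m (W *m c)) w.
    rewrite -lincombB addrAC subrr add0r ipE trmx_mul [in RHS]trmx_mul trmxK.
    by rewrite trmx_mul mulmxA.
  under eq_fun do rewrite !LE.
  rewrite noise_cov ipE; congr EFin.
  rewrite -scalemxAr [RHS]mxE; congr (_ * _).
  by rewrite [in LHS]trmx_mul trmxK !mulmxA.
Qed.

End gaussian_noise.

(** * Ridge estimation from noisy X-ray data *)

Section ridgeless_estimator.
Context {R : realType} {T : Type} {K : T -> T -> R} (H : rkhs K) {N M : nat}.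
Variable phi : 'I_N -> 'I_M -> T -> R.
Hypothesis Hphi : forall i j, H (phi i j).
Local Notation W := (gram H phi).

Lemma lincomb_alpha_hat_cvg (Y : 'cV[R]_(N * M)) :
  hnorm H (lincomb phi (alpha_hat W Y nu) - lincomb phi (moore_penrose W *m Y))
    @[nu --> 0^'+] --> (0 : R).
Proof.
have Wpsd := gram_psd Hphi; have bound := gram_err_le Y Wpsd.
set C := sqnorm _ + sqnorm _ in bound.
have C0 : 0 <= C by rewrite addr_ge0 ?sqnorm_ge0.
apply/cvgrPdist_lt => e e0; near=> nu.
have nu0 : 0 < nu by near: nu; exact: nbhs_right_gt.
rewrite sub0r normrN ger0_norm ?sqrtr_ge0// -lincombB /hnorm ip_lincomb//.
apply: le_lt_trans (ler_wsqrtr (bound nu nu0)) _.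
rewrite sqrtrM ?sqr_ge0// sqrtr_sqr gtr0_norm//.
have c0 : 0 < Num.sqrt C + 1 by rewrite ltr_wpDl// sqrtr_ge0.
apply: (@le_lt_trans _ _ (nu * (Num.sqrt C + 1))).
  by rewrite ler_wpM2l ?lerDl// ltW.
rewrite -ltr_pdivlMr//.
by near: nu; apply: nbhs_right_lt; rewrite divr_gt0.
Unshelve. all: by end_near. Qed.

(** Orthogonality of the residual to each $\psi_k$ says that $f$ and its projection have
    the same samples. *)
Lemma samples_orth_proj (f : T -> R) (a : 'cV[R]_(N * M)) : H f ->
  is_orth_proj H (fspan phi) f (lincomb phi a) -> samples H phi f = W *m a.
Proof.
move=> Hf [_ orth]; have Ha := rkhs_lincomb Hphi a.
rewrite -samples_lincomb//; apply/eqP; rewrite -subr_eq0 -samplesB//; apply/eqP.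
apply/colP => k; rewrite samplesE [RHS]mxE; apply: orth.
exists (delta_mx k 0) => //; rewrite lincombE (bigD1 k)//= mxE !eqxx scale1r.
by rewrite big1 ?addr0// => l lk; rewrite mxE (negbTE lk) scale0r.
Qed.

End ridgeless_estimator.

Theorem theorem3p9 (R : realType) (n N M : nat) (hn : (2 <= n)%N)
  (K : cball R n -> cball R n -> R) (hK : reproducing_kernel K) (H : rkhs K)
  (U : 'I_N -> 'M[R]_n) (hU : forall i, SO (U i))
  (x : 'I_M -> cball R n.-1)
  (hKU : forall i, induced_kernel_exists K (U i))
  (HU : forall i, rkhs (induced_kernel K (U i)))
  (hxray : forall i f, H f -> xray_exists (U i) f)
  (hbounded : forall i, bounded_operator H (HU i) (xray (U i)))
  (Padj : 'I_N -> (cball R n.-1 -> R) -> cball R n -> R)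
  (hadj : forall i, is_adjoint H (HU i) (xray (U i)) (Padj i))
  (f0 : cball R n -> R) (hf0 : H f0)
  (d : measure_display) (Omega : measurableType d) (P : probability Omega R)
  (sigma : R) (eps : 'I_N -> 'I_M -> Omega -> R)
  (heps_law : forall i j, has_law P (eps i j) (normal_law 0 (sigma ^+ 2)))
  (heps_indep :
     mutually_independent P (fun k : 'I_N * 'I_M => eps k.1 k.2)) :
  let phi i j : cball R n -> R :=
    Padj i (fun x' => induced_kernel K (U i) x' (x j)) in
  let HF := fspan phi in
  let W := gram H phi in
  let y w i j : R := xray (U i) f0 (x j) + eps i j w in
  let Y w := vec (y w) in
  let fhat nu w := lincomb phi (alpha_hat W (Y w) nu) in
  forall (alpha0 : 'cV[R]_(N * M)),
  is_orth_proj H HF f0 (lincomb phi alpha0) ->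
  (forall nu : R, 0 < nu ->
    let V := invmx (W + nu%:M) in
    [/\ (* (1) *)
        W + nu%:M \in unitmx /\
        forall w,
          [/\ HF (fhat nu w), H (fhat nu w),
              forall f, H f ->
                emp_risk H U x nu (y w) (fhat nu w) <= emp_risk H U x nu (y w) f
            & forall f, H f ->
                (forall g, H g ->
                   emp_risk H U x nu (y w) f <= emp_risk H U x nu (y w) g) ->
                f = fhat nu w],
        (* (2) *)
        forall w,
          let r := nu * ((Y w)^T *m V *m Y w) 0 0 in
          [/\ is_min [set emp_risk H U x nu (y w) f | f in carrier H] r,
              is_min (range (emp_risk_vec W nu (Y w))) r
            & emp_risk_vec W nu (Y w) (alpha_hat W (Y w) nu) = r]
      & (* (3) *)
        gaussian_vector P (fun w => alpha_hat W (Y w) nu)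
          (W *m V *m alpha0) (sigma ^+ 2 *: (V *m V)) /\
        gaussian_element P H HF (fhat nu)
          (gram_iso_inv H phi (W *m W *m V *m alpha0))
          (fun h => sigma ^+ 2 *:
             gram_iso_inv H phi (W *m (V *m V) *m gram_iso H phi h))]) /\
  (* (4) *)
  (forall w,
    let alphahat0 := moore_penrose W *m Y w in
    let fhat0 := lincomb phi alphahat0 in
    ((exists b : 'cV[R]_(N * M), Y w = W *m b) ->
       alpha_hat W (Y w) nu @[nu --> 0^'+] --> alphahat0) /\
    [/\ HF fhat0, H fhat0
      & hnorm H (fhat nu w - fhat0) @[nu --> 0^'+] --> (0 : R)]).
Proof.
move=> phi HF W y Y fhat alpha0 proj0.
have Hphi i j : H (phi i j) by apply: (hadj i).1; exact: rkhs_kernel.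
have Wpsd := gram_psd Hphi; rewrite -/W in Wpsd.
(* The reproducing property in the induced space, transported by the adjoint. *)
have xrayE f i j : H f -> xray (U i) f (x j) = ip H f (phi i j).
  move=> Hf; have [HUf _ _] := hbounded i; have [_ adj] := hadj i.
  by rewrite (rkhs_reproducing (x j) (HUf f Hf)) adj//; exact: rkhs_kernel.
have YE w : Y w = W *m alpha0 + noise eps w.
  rewrite -(samples_orth_proj Hphi hf0 proj0); apply/colP => k.
  have [i [j ->]] := mxvec_index_surj k.
  by rewrite [RHS]mxE samplesE /noise !vecE /y xrayE.
have riskE nu w f : H f ->
    emp_risk H U x nu (y w) f = sqnorm (Y w - samples H phi f) + nu * hnorm H f ^+ 2.
  move=> Hf; rewrite /emp_risk /sqnorm -sum_mxvec_index; congr (_ + _).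
  apply: eq_bigr => i _; apply: eq_bigr => j _.
  by rewrite [(Y w - _) _ _]mxE [(- _ : matrix _ _ _) _ _]mxE samplesE !vecE xrayE.
have Hlin a : H (lincomb phi a) by exact: rkhs_lincomb.
have risk_vecE nu w a :
    emp_risk H U x nu (y w) (lincomb phi a) = emp_risk_vec W nu (Y w) a.
  by rewrite riskE// risk_lincomb.
split.
- move=> nu nu0 V.
  have Vsym : V^T = V by exact: resolvent_tr.
  have VW : V *m W = W *m V by exact: resolvent_comm.
  have minP w f : H f -> emp_risk H U x nu (y w) (fhat nu w) <= emp_risk H U x nu (y w) f.
    by move=> Hf; rewrite (riskE _ _ _ (Hlin _)) (riskE _ _ _ Hf); exact: ridge_min.
  have minE w : emp_risk H U x nu (y w) (fhat nu w) = nu * ((Y w)^T *m V *m Y w) 0 0.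
    by rewrite risk_vecE emp_risk_vec_min.
  have ahatE w : alpha_hat W (Y w) nu = W *m V *m alpha0 + V *m noise eps w.
    by rewrite /alpha_hat YE mulmxDr -/V mulmxA VW.
  split.
  + split; first exact: resolvent_unit.
    move=> w; split; [by exists (alpha_hat W (Y w) nu) | exact: Hlin | exact: minP |].
    move=> f Hf fmin; apply: (ridge_min_unique Hphi (Y := Y w) nu0) => //.
    rewrite -(riskE _ _ _ Hf) -(riskE _ _ _ (Hlin _)); apply: fmin; exact: Hlin.
  + move=> w r; split.
    * split; first by exists (fhat nu w); [exact: Hlin | exact: minE].
      by move=> _ [f Hf <-]; rewrite /r -minE; exact: minP.
    * split; first by exists (alpha_hat W (Y w) nu); rewrite // -risk_vecE minE.
      by move=> _ [a _ <-]; rewrite /r -minE -risk_vecE; exact: minP.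
    * by rewrite -risk_vecE minE.
  + split.
      (* the second factor of the covariance V V is read as V^T *)
      rewrite -{3}Vsym; under eq_fun do rewrite ahatE.
      exact: gaussian_vector_affine.
    have -> : fhat nu = fun w => lincomb phi (W *m V *m alpha0 + V *m noise eps w).
      by apply/funext => w; rewrite /fhat ahatE.
    rewrite -!mulmxA gram_iso_invE//.
    have -> : (fun h => sigma ^+ 2 *: gram_iso_inv H phi (W *m (V *m V) *m gram_iso H phi h))
        = (fun h => lincomb phi (sigma ^+ 2 *: (V *m V^T *m gram_iso H phi h))).
      by apply/funext => h; rewrite -mulmxA gram_iso_invE// lincombZ Vsym.
    rewrite mulmxA; exact: gaussian_element_affine.
- move=> w a f; split; first exact: alpha_hat_cvg.
  split; [by exists a | exact: Hlin | exact: lincomb_alpha_hat_cvg].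
Qed.
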